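(* Let $n_0,d_0\ge 1$ be integers, $\boldsymbol{\beta}_0\in\mathbb{R}^{d_0}$, $\sigma^2>0$, and for each integer $n\ge 1$ let the training set $\mathcal{D}_{(n)}$ (sequence II), the estimator $\hat{\boldsymbol{\beta}}_{(n)}$ and the test error $R_{(n)}\in[0,\infty]$ be as defined in the context. Then the following hold. (i) For $n<\min(n_0,d_0)$, the estimator is minimum norm OLS and $$R_{(n)}=\begin{cases}\|\boldsymbol{\beta}_0\|^2\Big(1-\dfrac{n}{d_0}\Big)+\sigma^2\Big(1+\dfrac{n}{d_0-1-n}\Big), & n\le d_0-2,\\[2mm] \infty, & n\in\{d_0-1,d_0\}.\end{cases}$$ (ii) If $n_0<d_0$ and $n_0\le n<d_0$, the estimator is minimum norm OLS and $$\begin{aligned}R_{(n)}&=\sigma^2+\operatorname{E}\big\|(X^TA^{11}X+W^TA^{21}X-I_{d_0})\boldsymbol{\beta}_0\big\|^2\\&\quad+\sigma^2\operatorname{E}\operatorname{trace}\big\{A^{11}XX^TA^{11}+(A^{21})^TWX^TA^{11}+A^{11}XW^TA^{21}+(A^{21})^TWW^TA^{21}\big\},\end{aligned}$$ where $A^{11}=\{XX^T-XW^T(WW^T)^{-1}WX^T\}^{-1}$ and $A^{21}=-(WW^T)^{-1}WX^TA^{11}$. (iii) If $d_0<n_0$ and $d_0\le n<n_0$, the estimator is OLS and $$R_{(n)}=\begin{cases}\infty, & n\in\{d_0,d_0+1\},\\[1mm] \sigma^2\Big(1+\dfrac{d_0}{n-d_0-1}\Big), & n\ge d_0+2.\end{cases}$$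 (iv) If $n>\max(n_0,d_0)$, the estimator is OLS and $$R_{(n)}=\sigma^2+\operatorname{E}\big\|\{(X^TX+W^TW)^{-1}X^TX-I_{d_0}\}\boldsymbol{\beta}_0\big\|^2+\sigma^2\operatorname{E}\operatorname{trace}\big\{X^TX(X^TX+W^TW)^{-2}\big\}.$$
   Context: Data model: $X$ is an $n_0\times d_0$ random matrix whose rows are independent $N_{d_0}(0,I_{d_0})$; $y=X\boldsymbol{\beta}_0+e$ with $e\sim N_{n_0}(0,\sigma^2I_{n_0})$ independent of $X$. Sequence II (adding observations, $d=d_0$ fixed): for $n\le n_0$, the training set is $\mathcal{D}_{(n)}=(y_{(n)},X_{(n)})$, where $y_{(n)}$ consists of the first $n$ entries of $y$ and $X_{(n)}$ of the first $n$ rows of $X$. For $n>n_0$, $\mathcal{D}_{(n)}=([y^T,0_{n-n_0}^T]^T,[X^T,W^T]^T)$, where $W$ is an $(n-n_0)\times d_0$ matrix with independent $N_{d_0}(0,I_{d_0})$ rows, independent of $X$ and $e$ (so the added noise observations have response $0$). When $n=n_0$, $W$ is the empty matrix with $0$ rows and all terms involving $W$ are absent (so $A^{11}=(XX^T)^{-1}$). Estimator: writing $\mathcal{D}_{(n)}=(u,D)$ with $u\in\mathbb{R}^n$ and $D\in\mathbb{R}^{n\times d_0}$ (almost surely of full rank), $\hat{\boldsymbol{\beta}}_{(n)}$ is the OLS estimator $(D^TD)^{-1}D^Tu$ if $n\ge d_0$, and the minimum norm OLS estimator $D^T(DD^T)^{-1}u$ if $n<d_0$ (the two formulas coincide when $n=d_0$).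 Test error: let $x'\sim N_{d_0}(0,I_{d_0})$ and $y'=x'^T\boldsymbol{\beta}_0+e'$ with $e'\sim N(0,\sigma^2)$, where $x'$ and $e'$ are independent of each other and of the training data. Then $R_{(n)}=\operatorname{E}\{(y'-x'^T\hat{\boldsymbol{\beta}}_{(n)})^2\}$, the expectation being over $(y',x')$ and the training data, with values in $[0,\infty]$. $\|\cdot\|$ is the Euclidean norm. *)

(* Defs.v *)
From HB Require Import structures.
From mathcomp Require Import all_boot all_order all_algebra.
From mathcomp Require Import all_classical all_reals all_analysis.

Set Implicit Arguments.
Unset Strict Implicit.
Unset Printing Implicit Defensive.

Import Order.TTheory GRing.Theory Num.Theory.

Local Open Scope classical_set_scope.
Local Open Scope ring_scope.

Section LinearAlgebra.
Context {R : realType}.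

(* Euclidean norm; the library norm [`|v|] on matrices is the sup norm. *)
Definition enorm (k : nat) (v : 'cV[R]_k) : R :=
  Num.sqrt (\sum_(i < k) v i 0 ^+ 2).

Definition dotv (k : nat) (u v : 'cV[R]_k) : R := \sum_(i < k) u i 0 * v i 0.

Definition ols (n d : nat) (D : 'M[R]_(n, d)) (u : 'cV[R]_n) : 'cV[R]_d :=
  invmx (D^T *m D) *m D^T *m u.

Definition min_norm_ols (n d : nat) (D : 'M[R]_(n, d)) (u : 'cV[R]_n) :
    'cV[R]_d :=
  D^T *m invmx (D *m D^T) *m u.

Definition estimator (n d : nat) (D : 'M[R]_(n, d)) (u : 'cV[R]_n) :
    'cV[R]_d :=
  if (d <= n)%N then ols D u else min_norm_ols D u.

Lemma leq_train (n0 n : nat) : (n <= n0 + (n - n0))%N.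
Proof. by rewrite -leq_subLR. Qed.

(* The first [n] rows of [X] stacked on top of [W]. The subtraction [n - n0] is
   truncated, so [W] has no row when [n <= n0], and then these are the first [n]
   rows of [X]; when [n0 < n], they are all the rows of [X] and [W]. *)
Definition train_design (n0 d n : nat) (X : 'M[R]_(n0, d))
    (W : 'M[R]_(n - n0, d)) : 'M[R]_(n, d) :=
  rowsub (widen_ord (leq_train n0 n)) (col_mx X W).

Definition train_response (n0 n : nat) (y : 'cV[R]_n0) : 'cV[R]_n :=
  rowsub (widen_ord (leq_train n0 n)) (col_mx y (0 : 'cV[R]_(n - n0))).

(* When [W] has no row, [A11 X W] is [(X X^T)^-1], and the products involving
   [W^T] below and in the theorem are sums over an empty index, hence zero. *)
Definition A11 (n0 m d : nat) (X : 'M[R]_(n0, d)) (W : 'M[R]_(m, d)) :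
    'M[R]_n0 :=
  invmx (X *m X^T - X *m W^T *m invmx (W *m W^T) *m W *m X^T).

Definition A21 (n0 m d : nat) (X : 'M[R]_(n0, d)) (W : 'M[R]_(m, d)) :
    'M[R]_(m, n0) :=
  - (invmx (W *m W^T) *m W *m X^T *m A11 X W).

End LinearAlgebra.

Section Probability.
Context {dsp : measure_display} {T : measurableType dsp} {R : realType}.
Variable P : probability T R.

Definition rv_sigma (f : T -> R) : set (set T) :=
  preimage_set_system setT f measurable.

(* The sigma-algebra generated by a random matrix is the one generated by its
   entries. *)
Definition mx_sigma (m n : nat) (V : T -> 'M[R]_(m, n)) : set (set T) :=
  <<s \bigcup_(ij in [set: 'I_m * 'I_n])
        rv_sigma (fun w => V w ij.1 ij.2) >>.

Definition mutually_independent (I : finType) (F : I -> set (set T)) : Prop :=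
  forall (J : {set I}) (E : I -> set T),
    (forall i, i \in J -> F i (E i)) ->
    P (\bigcap_(i in [set` J]) E i) = (\prod_(i in J) P (E i))%E.

(* [s] is the standard deviation, as in the library's [normal_prob]. *)
Definition normal_rv (m s : R) (f : T -> R) : Prop :=
  measurable_fun setT f /\
  forall B : set R, measurable B -> pushforward P f B = normal_prob m s B.

(* The law N_k(0, s^2 I_k): independent N(0, s^2) coordinates. *)
Definition isotropic_normal (s : R) (k : nat) (V : T -> 'cV[R]_k) : Prop :=
  (forall i, normal_rv 0 s (fun w => V w i 0)) /\
  mutually_independent (fun i => rv_sigma (fun w => V w i 0)).

Definition independent_std_normal_rows (m d : nat) (V : T -> 'M[R]_(m, d)) :
    Prop :=
  (forall i, isotropic_normal 1 (fun w => (row i (V w))^T)) /\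
  mutually_independent (fun i => mx_sigma (fun w => row i (V w))).

Definition data_model (n0 m d : nat) (sigma : R)
    (X : T -> 'M[R]_(n0, d)) (e : T -> 'cV[R]_n0) (W : T -> 'M[R]_(m, d))
    (x' : T -> 'cV[R]_d) (e' : T -> R) : Prop :=
  [/\ independent_std_normal_rows X,
      isotropic_normal sigma e,
      independent_std_normal_rows W,
      isotropic_normal 1 x' /\ normal_rv 0 sigma e'
    & mutually_independent (fun i : 'I_5 =>
        nth set0 [:: mx_sigma X; mx_sigma e; mx_sigma W; mx_sigma x';
                     rv_sigma e'] i)].

Definition betahat (n0 d : nat) (beta0 : 'cV[R]_d)
    (X : T -> 'M[R]_(n0, d)) (e : T -> 'cV[R]_n0) (n : nat)
    (W : T -> 'M[R]_(n - n0, d)) (w : T) : 'cV[R]_d :=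
  estimator (train_design (X w) (W w))
            (train_response n (X w *m beta0 + e w)).

Definition test_error (n0 d : nat) (beta0 : 'cV[R]_d)
    (X : T -> 'M[R]_(n0, d)) (e : T -> 'cV[R]_n0) (n : nat)
    (W : T -> 'M[R]_(n - n0, d)) (x' : T -> 'cV[R]_d) (e' : T -> R) : \bar R :=
  'E_P[fun w => ((dotv (x' w) beta0 + e' w
                  - dotv (x' w) (betahat beta0 X e W w)) ^+ 2)%R]%E.

End Probability.

(* Main.v *)
Require Import Defs.
From HB Require Import structures.
From mathcomp Require Import all_boot all_order all_algebra fingroup perm.
From mathcomp Require Import all_classical all_reals all_analysis measurable_realfun.
From mathcomp Require Import zify ring lra.

Set Implicit Arguments.
Unset Strict Implicit.
Unset Printing Implicit Defensive.

Import Order.TTheory GRing.Theory Num.Theory.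
Import numFieldNormedType.Exports.

Local Open Scope classical_set_scope.
Local Open Scope ring_scope.

(** The estimator is linear in the responses: it equals [M (X beta0 + e)], where the
    matrix [M] depends only on the design, that is on [X] and [W]. The test point and
    the noises are centred and independent of the design; averaging over them first,
    with the design frozen, gives ([test_error_decomposition])

      [R = sigma^2 + E |(M X - 1) beta0|^2 + sigma^2 E tr (M M^T)].

    Everything averaged is nonnegative, so Tonelli's theorem gives this identity in
    [[0, +oo]] without any moment assumption. Parts (ii) and (iv) are this formula with
    [M] made explicit; in (ii) this is a block inversion of the Gram matrix of the
    stacked design ([gram_inv_first_block]), valid almost surely because Gaussian
    matrices have full rank ([gaussian_gram_unit]).

    Without noise observations the training design [D] is an [n x d0] Gaussian matrix.
    In (i), [M X - 1] is minus the projection on the kernel of [D]. Changing the sign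
    of a column of [D], or swapping two columns, preserves the law, so all directions
    lose on average the same share of their squared length; the shares add up to the
    dimension [d0 - n] of the kernel ([expected_proj_defect]). In (iii) there is no
    bias. In both cases the variance is [E tr (G G^T)^-1] for a Gaussian [p x q] matrix
    [G] with [p <= q], namely [G = D] or [G = D^T]: it equals [p / (q - p - 1)] when
    [q >= p + 2] and is infinite otherwise ([expected_trace_inverse]).

    That expectation is computed by integration by parts. Put
    [S = G G^T + eps], [a = tr S^-1] and [b = tr S^-2]. Integration by parts in each
    entry of [S^-1 G] gives, after summation ([stein_haff]),

      [E ((q - p - 1) a + eps a^2 + eps b + eps a) = p].

    When [E tr (G G^T)^-1] is finite, dominated convergence as [eps] tends to 0 leaves
    [(q - p - 1) E tr (G G^T)^-1 = p], which is absurd for [q <= p + 1]. When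
    [q >= p + 2] the identity bounds [E a] uniformly in [eps], and Fatou's lemma gives
    the finiteness.

    All probabilistic input goes through families of independent centred normal
    variables ([indep_normal]): integrals depend only on the law of the family
    ([ge0_integral_same_law]), and two independent copies may be mixed coordinatewise
    ([ge0_integral_mix]), which replaces conditioning. *)

(** * Laws of finite families of independent centred normal variables *)

Section FamilyLaw.
Context {R : realType} {I : finType}.

Definition cylinders : set (set (I -> R)) :=
  [set A | exists2 B : I -> set R, (forall i, measurable (B i))
         & A = [set z | forall i, B i (z i)]].

(** The functions on [I] under another name, which carries the product
    sigma-algebra generated by the cylinders. *)
Definition family := g_sigma_algebraType cylinders.

HB.instance Definition _ := Measurable.on family.

Lemma measurable_family d (T : measurableType d) (Z : T -> I -> R) :
  (forall i, measurable_fun setT (fun w => Z w i)) ->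
  measurable_fun setT (Z : T -> family).
Proof.
move=> mZ; apply: (@measurability _ _ T family setT Z cylinders) => //.
move=> _ [_ [B mB ->]] <-; rewrite setTI.
have -> : Z @^-1` [set z | forall i, B i (z i)] =
    \bigcap_(i in [set: I]) ((fun w => Z w i) @^-1` B i).
  by apply/seteqP; split=> w /= h i => [_|]; apply: h.
apply: fin_bigcap_measurable => [|i _]; first exact: finite_finset.
by rewrite -[X in measurable X]setTI; exact: mZ.
Qed.

Lemma measurable_coord (i : I) : measurable_fun setT (fun z : family => z i : R).
Proof.
move=> _ B mB; rewrite setTI; apply: sub_sigma_algebra.
exists (fun j => if j == i then B else setT).
  by move=> j; case: ifP => _ //; exact: measurableT.
apply/seteqP; split=> z /= h.
  by move=> j; case: eqP => // ->.
by move: (h i); rewrite eqxx.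
Qed.

(** The scales may differ from one index to the other, so that designs and noises
    can be coordinates of a single family. *)
Definition indep_normal (s : I -> R) d (T : measurableType d)
    (P : set T -> \bar R) (Z : T -> I -> R) : Prop :=
  (forall i, measurable_fun setT (fun w => Z w i)) /\
  forall B : I -> set R, (forall i, measurable (B i)) ->
    P [set w | forall i, B i (Z w i)] = (\prod_i normal_prob 0 (s i) (B i))%E.

(** Cylinders are stable under intersection and generate the sigma-algebra, so a
    probability is determined by its values on them. *)
Lemma indep_normal_law_unique (s : I -> R) d1 (T1 : measurableType d1)
    (P1 : probability T1 R) (Z1 : T1 -> I -> R) d2 (T2 : measurableType d2)
    (P2 : probability T2 R) (Z2 : T2 -> I -> R) :
  indep_normal s P1 Z1 -> indep_normal s P2 Z2 ->
  forall A : set family, measurable A -> P1 (Z1 @^-1` A) = P2 (Z2 @^-1` A).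
Proof.
move=> [mZ1 Z1P] [mZ2 Z2P] A mA.
have mZ1' : measurable_fun setT (Z1 : T1 -> family) by exact: measurable_family.
have mZ2' : measurable_fun setT (Z2 : T2 -> family) by exact: measurable_family.
pose Y1 := HB.pack_for {mfun T1 >-> family} (Z1 : T1 -> family)
  (isMeasurableFun.Build _ _ _ _ _ mZ1').
pose Y2 := HB.pack_for {mfun T2 >-> family} (Z2 : T2 -> family)
  (isMeasurableFun.Build _ _ _ _ _ mZ2').
change (distribution P1 Y1 A = distribution P2 Y2 A).
apply: (@measure_unique _ R family cylinders (fun _ => setT)) => //.
- move=> _ _ [B mB ->] [C mC ->]; exists (fun i => B i `&` C i).
    by move=> i; exact: measurableI.
  apply/seteqP; split=> z /=; first by move=> [h k] i; split; [exact: h|exact: k].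
  by move=> h; split=> i; case: (h i).
- move=> _; exists (fun _ => setT) => [i|]; first exact: measurableT.
  by apply/seteqP; split.
- by rewrite bigcup_const.
- move=> _ [B mB ->]; rewrite /distribution /pushforward /=.
  by rewrite [LHS](Z1P B mB) [RHS](Z2P B mB).
- by move=> k; rewrite /= probability_setT ltry.
Qed.

(** Everything that depends only on the law may be computed on any other
    probability space carrying a family with that law. *)
Lemma ge0_integral_same_law (s : I -> R) d1 (T1 : measurableType d1)
    (P1 : probability T1 R) (Z1 : T1 -> I -> R) d2 (T2 : measurableType d2)
    (P2 : probability T2 R) (Z2 : T2 -> I -> R) (f : family -> \bar R) :
  indep_normal s P1 Z1 -> indep_normal s P2 Z2 ->
  measurable_fun setT f -> (forall z, 0 <= f z)%E ->
  (\int[P1]_w f (Z1 w) = \int[P2]_w f (Z2 w))%E.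
Proof.
move=> h1 h2 mf f0; have [mZ1 _] := h1; have [mZ2 _] := h2.
have mZ1' : measurable_fun setT (Z1 : T1 -> family) by exact: measurable_family.
have mZ2' : measurable_fun setT (Z2 : T2 -> family) by exact: measurable_family.
pose Y1 := HB.pack_for {mfun T1 >-> family} (Z1 : T1 -> family)
  (isMeasurableFun.Build _ _ _ _ _ mZ1').
pose Y2 := HB.pack_for {mfun T2 >-> family} (Z2 : T2 -> family)
  (isMeasurableFun.Build _ _ _ _ _ mZ2').
have e1 := @ge0_integral_pushforward _ _ T1 family R Y1 mZ1' P1 setT f measurableT mf
  (fun _ _ => f0 _).
have e2 := @ge0_integral_pushforward _ _ T2 family R Y2 mZ2' P2 setT f measurableT mf
  (fun _ _ => f0 _).
rewrite preimage_setT in e1; rewrite preimage_setT in e2.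
rewrite [LHS](esym e1) [RHS](esym e2).
apply: (eq_measure_integral (distribution P2 Y2) (m1 := distribution P1 Y1)).
by move=> A mA _; exact: indep_normal_law_unique h1 h2 A mA.
Qed.

End FamilyLaw.
Arguments family R I : clear implicits.

Section FamilyTransforms.
Context {R : realType}.

Lemma big_mule_support (I : finType) (A : pred I) (F : I -> \bar R) :
  (forall i, ~~ A i -> F i = 1%E) -> (\prod_i F i = \prod_(i | A i) F i)%E.
Proof.
move=> F1; rewrite (bigID A) /= [X in (_ * X)%E]big1 ?mule1 //.
Qed.

(** The coordinates outside the range of [g] are left free, which costs a factor
    of probability one each. *)
Lemma indep_normal_reindex (I J : finType) (g : J -> I) (s : I -> R) d
    (T : measurableType d) (P : probability T R) (Z : T -> I -> R) :
  injective g -> indep_normal s P Z ->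
  indep_normal (s \o g) P (fun w j => Z w (g j)).
Proof.
move=> g_inj [mZ ZP]; split=> [j|B mB]; first exact: mZ.
pose B' i := if [pick j | g j == i] is Some j then B j else setT.
have B'g j : B' (g j) = B j.
  rewrite /B'; case: pickP => [k /eqP/g_inj -> //|/(_ j)]; by rewrite eqxx.
have -> : [set w | forall j, B j (Z w (g j))] =
    [set w | forall i, B' i (Z w i)].
  apply/seteqP; split=> w /= h; last by move=> j; move: (h (g j)); rewrite B'g.
  by move=> i; rewrite /B'; case: pickP => [j /eqP <-|//]; exact: h.
rewrite ZP; last first.
  by move=> i; rewrite /B'; case: pickP => // _; exact: measurableT.
rewrite (@big_mule_support _ (mem [set g j | j in J]%SET)); last first.
  move=> i /imsetP gi; rewrite /B'; case: pickP => [j /eqP gj|_].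
    by exfalso; apply: gi; exists j.
  exact: probability_setT.
rewrite big_imset /=; last by move=> ? ? _ _; exact: g_inj.
by apply: eq_bigr => j _; rewrite B'g.
Qed.

Lemma normal_prob_opp (s : R) (B : set R) : s != 0 -> measurable B ->
  normal_prob 0 s (-%R @^-1` B) = normal_prob 0 s B.
Proof.
move=> s0 mB; rewrite /normal_prob.
pose opp : measurableTypeR R -> measurableTypeR R := -%R.
have mopp : measurable_fun setT opp by exact: oppr_measurable.
pose f (x : measurableTypeR R) := (normal_pdf 0 s x)%:E.
have mf : measurable_fun B f.
  by apply/measurable_EFinP; apply: measurable_funTS; exact: measurable_normal_pdf.
have f0 : {in B, forall y, 0 <= f y}%E.
  by move=> x _; rewrite lee_fin normal_pdf_ge0.
transitivity (\int[lebesgue_measure]_(x in opp @^-1` B) (f \o opp) x)%E.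
  apply: eq_integral => x _ /=; rewrite /f /opp !normal_pdfE // /normal_fun.
  by rewrite !subr0 sqrrN.
rewrite -(ge0_integral_pushforward mopp lebesgue_measure mB mf f0).
by apply: eq_measure_integral => A mA _; exact: lebesgue_measureN.
Qed.

(** Centred normal laws are symmetric. The scales must be nonzero: at scale zero
    [normal_prob] is the uniform law on the unit interval. *)
Lemma indep_normal_sign (I : finType) (neg : pred I) (s : I -> R) d
    (T : measurableType d) (P : probability T R) (Z : T -> I -> R) :
  (forall i, s i != 0) -> indep_normal s P Z ->
  indep_normal s P (fun w i => (-1) ^+ neg i * Z w i).
Proof.
move=> s0 [mZ ZP]; split=> [i|B mB].
  by apply: measurable_funM => //; exact: mZ.
pose B' i := if neg i then -%R @^-1` B i else B i.
have mB' i : measurable (B' i).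
  rewrite /B'; case: ifP => // _; rewrite -[X in measurable X]setTI.
  exact: oppr_measurable.
have -> : [set w | forall i, B i ((-1) ^+ neg i * Z w i)] =
    [set w | forall i, B' i (Z w i)].
  apply/seteqP; split=> w /= h i; move: (h i); rewrite /B';
    by case: (neg i); rewrite ?expr0 ?expr1 ?mulN1r ?mul1r.
rewrite ZP //; apply: eq_bigr => i _; rewrite /B'; case: ifP => // _.
exact: normal_prob_opp.
Qed.

(** Two independent copies may be mixed coordinatewise; combined with Tonelli,
    this is how conditioning on some of the coordinates is carried out. *)
Lemma indep_normal_mix (I : finType) (J : pred I) (s : I -> R)
    d1 (T1 : measurableType d1) (P1 : probability T1 R) (Z1 : T1 -> I -> R)
    d2 (T2 : measurableType d2) (P2 : probability T2 R) (Z2 : T2 -> I -> R) :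
  indep_normal s P1 Z1 -> indep_normal s P2 Z2 ->
  indep_normal s (P1 \x P2)%E
    (fun w i => if J i then Z1 w.1 i else Z2 w.2 i).
Proof.
move=> [mZ1 Z1P] [mZ2 Z2P]; split=> [i|B mB].
  case: (J i); first exact: (measurableT_comp (mZ1 i) measurable_fst).
  exact: (measurableT_comp (mZ2 i) measurable_snd).
pose B1 i := if J i then B i else setT; pose B2 i := if J i then setT else B i.
have mB1 i : measurable (B1 i) by rewrite /B1; case: ifP.
have mB2 i : measurable (B2 i) by rewrite /B2; case: ifP.
have ev d (T : measurableType d) (Z : T -> I -> R) (C : I -> set R) :
    (forall i, measurable_fun setT (fun w => Z w i)) ->
    (forall i, measurable (C i)) -> measurable [set w | forall i, C i (Z w i)].
  move=> mZ mC.
  have -> : [set w | forall i, C i (Z w i)] =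
      \bigcap_(i in [set: I]) ((fun w => Z w i) @^-1` C i).
    by apply/seteqP; split=> w /= h i => [_|]; apply: h.
  apply: fin_bigcap_measurable => [|i _]; first exact: finite_finset.
  by rewrite -[X in measurable X]setTI; exact: mZ.
have -> : [set w : T1 * T2 | forall i, B i (if J i then Z1 w.1 i else Z2 w.2 i)] =
    [set w | forall i, B1 i (Z1 w i)] `*` [set w | forall i, B2 i (Z2 w i)].
  apply/seteqP; split=> [w /= h|w /= [h1 h2] i].
    by split=> i; move: (h i); rewrite /B1 /B2; case: (J i).
  by move: (h1 i) (h2 i); rewrite /B1 /B2; case: (J i).
rewrite product_measure1E; [|exact: ev..].
transitivity ((\prod_i normal_prob 0 (s i) (B1 i)) *
    (\prod_i normal_prob 0 (s i) (B2 i)))%E.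
  by congr (_ * _)%E; [exact: Z1P|exact: Z2P].
rewrite -big_split /=; apply: eq_bigr => i _.
by rewrite /B1 /B2; case: ifP => _; rewrite probability_setT ?mule1 ?mul1e.
Qed.

Lemma measurable_mix (I : finType) (J : pred I)
    d1 (T1 : measurableType d1) (Z1 : T1 -> I -> R)
    d2 (T2 : measurableType d2) (Z2 : T2 -> I -> R) (f : family R I -> \bar R) :
  (forall i, measurable_fun setT (fun w => Z1 w i)) ->
  (forall i, measurable_fun setT (fun w => Z2 w i)) ->
  measurable_fun setT f ->
  measurable_fun setT (fun w : T1 * T2 =>
    f (fun i => if J i then Z1 w.1 i else Z2 w.2 i)).
Proof.
move=> mZ1 mZ2 mf.
pose Z12 (w : T1 * T2) i := if J i then Z1 w.1 i else Z2 w.2 i.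
have mZ12 : measurable_fun setT (Z12 : T1 * T2 -> family R I).
  apply: measurable_family => i; rewrite /Z12.
  case: (J i); first exact: (measurableT_comp (mZ1 i) measurable_fst).
  exact: (measurableT_comp (mZ2 i) measurable_snd).
exact: (measurableT_comp mf mZ12).
Qed.

Lemma ge0_integral_mix (I : finType) (J : pred I) (s : I -> R) d
    (T : measurableType d) (P : probability T R) (Z : T -> I -> R)
    d2 (T2 : measurableType d2) (P2 : probability T2 R) (Z2 : T2 -> I -> R)
    (f : family R I -> \bar R) :
  indep_normal s P Z -> indep_normal s P2 Z2 ->
  measurable_fun setT f -> (forall z, 0 <= f z)%E ->
  (\int[P]_w f (Z w) =
   \int[P]_w1 \int[P2]_w2 f (fun i => if J i then Z w1 i else Z2 w2 i))%E.
Proof.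
move=> hZ hZ2 mf f0.
rewrite (ge0_integral_same_law hZ (indep_normal_mix J hZ hZ2) mf f0).
rewrite fubini_tonelli1 //; exact: (measurable_mix _ hZ.1 hZ2.1 mf).
Qed.

End FamilyTransforms.

(** * Integration by parts against one normal law *)

Section NormalIntegrationByParts.
Context {R : realType} (s : R).
Hypothesis s0 : s != 0.
Local Notation mu := (@lebesgue_measure R).
Local Notation N := (@normal_prob R 0 s).
Local Notation pdf := (@normal_pdf R 0 s).

(** The normal density is a Radon-Nikodym derivative with respect to the Lebesgue
    measure. *)
Lemma integral_normal_prob (f : R -> \bar R) (U : set R) : measurable U ->
  N.-integrable U f ->
  (\int[N]_(x in U) f x = \int[mu]_(x in U) (f x * (pdf x)%:E))%E.
Proof.
move=> mU fint; have mf := measurable_int _ fint.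
have dom : N `<< mu by exact: normal_prob_dominates.
rewrite -(Radon_Nikodym_change_of_variables dom) //=.
apply: ae_eq_integral => //.
- apply: emeasurable_funM => //; apply: (measurable_int mu).
  apply: (integrableS _ _ (@subsetT _ _)) => //=.
  by apply: Radon_Nikodym_integrable; exact: dom.
- apply: emeasurable_funM => //=; apply/measurable_EFinP.
  by apply/measurable_funTS; exact: measurable_normal_pdf.
- apply: ae_eqe_mul2l => /=.
  rewrite Radon_NikodymE//=.
  case: cid => /= h [h1 h2 h3].
  apply: integral_ae_eq => //=.
  + exact: integrableS h2.
  + by apply/measurable_EFinP/measurable_funTS; exact: measurable_normal_pdf.
  + by move=> E E01 mE; rewrite -h3.
Qed.

Lemma is_derive_normal_pdf (x : R) : is_derive x (1 : R) pdf (- x / s ^+ 2 * pdf x).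
Proof.
rewrite normal_pdfE //.
have h : is_derive x 1 (fun y : R => - (y - 0) ^+ 2 / (s ^+ 2 *+ 2))
    (- (x / s ^+ 2)).
  have -> : (fun y : R => - (y - 0) ^+ 2 / (s ^+ 2 *+ 2)) =
     (fun y : R => (- (s ^+ 2 *+ 2)^-1) *: (y * y)).
    by apply/funext => y; rewrite subr0 expr2 mulNr scaleNr mulrC.
  apply: is_derive_eq; rewrite /GRing.scale /= mulr1 -mulr2n -mulr_natl.
  by field.
have h2 := is_derive1_comp (is_derive_expR _) h.
have h3 := is_deriveZ (normal_peak s) h2.
apply: (is_derive_eq h3).
by rewrite /GRing.scale /= /normal_fun; ring.
Qed.

(** This is [t * exp (- t) <= 1], a consequence of [1 + t <= exp t], at
    [t = x^2 / (2 s^2)]. *)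
Lemma ger_sqr_normal_pdf (x : R) : x ^+ 2 * pdf x <= 2 * s ^+ 2 * normal_peak s.
Proof.
rewrite normal_pdfE // /normal_fun subr0.
have s2 : 0 < s ^+ 2 by rewrite exprn_even_gt0.
set t := x ^+ 2 / (s ^+ 2 *+ 2).
have -> : - x ^+ 2 / (s ^+ 2 *+ 2) = - t by rewrite /t mulNr.
have t0 : 0 <= t by rewrite /t divr_ge0 ?sqr_ge0 // mulrn_wge0 // ltW.
have xt : x ^+ 2 = 2 * s ^+ 2 * t by rewrite /t -mulr_natl; field.
have pk := normal_peak_ge0 s.
suff h : t * expR (- t) <= 1.
  rewrite xt (_ : _ * _ = 2 * s ^+ 2 * normal_peak s * (t * expR (- t))); last by ring.
  by rewrite ler_piMr // mulr_ge0 // mulr_ge0 // ltW.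
rewrite expRN ler_pdivrMr ?expR_gt0 // mul1r.
by apply: le_trans (expR_ge1Dx t); rewrite lerDr.
Qed.

Lemma continuous_itv_integrable_normal (g : R -> R) (a b : R) :
  continuous g -> N.-integrable `[a, b] (fun x => (g x)%:E).
Proof.
move=> cg; apply: measurable_bounded_integrable => //.
- by apply: le_lt_trans (probability_le1 N _) _; rewrite ?ltry.
- by apply: measurable_funTS; exact: continuous_measurable_fun.
- have cK : compact (g @` `[a, b]).
    apply: continuous_compact; last exact: segment_compact.
    exact: continuous_subspaceT.
  have [M [Mr h]] := compact_bounded cK.
  by exists M; split => // y My x xab; apply: (h y My); exists x.
Qed.

(** The integrand times the density is the derivative of [s^2 * f * pdf]. *)
Lemma integral_normal_itv (f f' : R -> R) (n : nat) :
  (forall x : R, is_derive x (1 : R) f (f' x)) -> continuous f' ->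
  (\int[N]_(x in `[(- n%:R)%R, n%:R]) (s ^+ 2 * f' x - x * f x)%:E =
   (s ^+ 2 * (f n%:R * pdf n%:R - f (- n%:R) * pdf (- n%:R)))%:E)%E.
Proof.
move=> df cf'.
have cf : continuous f by move=> x; apply/differentiable_continuous/derivable1_diffP; case: (df x).
have cg : continuous (fun x => s ^+ 2 * f' x - x * f x).
  move=> x; apply: cvgB; first by apply: cvgM; [exact: cvg_cst|exact: cf'].
  by apply: cvgM; [exact: cvg_id|exact: cf].
have ctg : {in setT, continuous (fun x => s ^+ 2 * f' x - x * f x)} by move=> x _; exact: cg.
have cpdf : continuous pdf by exact: continuous_normal_pdf.
have mg (A : set R) : measurable A ->
    measurable_fun A (fun x => s ^+ 2 * f' x - x * f x).
  by move=> mA; apply: measurable_funTS; exact: continuous_measurable_fun.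
rewrite integral_normal_prob //; last first.
  apply: continuous_itv_integrable_normal; exact: cg.
have [->|n0] := eqVneq n 0.
  rewrite oppr0 set_itv1 integral_set1 ?subrr ?mulr0 //.
pose F x := s ^+ 2 * (f x * pdf x).
have dF (x : R) : is_derive x (1 : R) F ((s ^+ 2 * f' x - x * f x) * pdf x).
  have h := is_deriveZ (s ^+ 2) (is_deriveM (df x) (is_derive_normal_pdf x)).
  by apply: (is_derive_eq h); rewrite /GRing.scale /=; field.
have cF : continuous F.
  by move=> x; apply/differentiable_continuous/derivable1_diffP; case: (dF x).
under eq_integral do rewrite -EFinM.
rewrite (@continuous_FTC2 _ _ F) //.
- by rewrite -EFinB /F mulrBr.
- by rewrite -subr_gt0 opprK -natrD ltr0n addn_gt0 lt0n n0.
- apply: continuous_subspaceT => x; apply: cvgM; [exact: cg|exact: cpdf].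
- split; first by move=> x _; case: (dF x).
  + by apply: cvg_at_right_filter; exact: cF.
  + by apply: cvg_at_left_filter; exact: cF.
- by move=> x _; rewrite derive1E; case: (dF x).
Qed.

Lemma cvg_boundary_normal (f : R -> R) (C : R) :
  (forall x, `|f x| <= C * (1 + `|x|)) ->
  (fun n => s ^+ 2 * (f n.+1%:R * pdf n.+1%:R - f (- n.+1%:R) * pdf (- n.+1%:R)))
    @ \oo --> (0 : R).
Proof.
move=> fC.
have s2 : 0 < s ^+ 2 by rewrite exprn_even_gt0.
pose K := 2 * s ^+ 2 * normal_peak s.
have C0 : 0 <= C by have := fC 0; rewrite normr0 addr0 mulr1; apply: le_trans.
have K0 : 0 <= K by rewrite /K mulr_ge0 // ?normal_peak_ge0 // mulr_ge0 // ltW.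
have bnd n (x : R) : `|x| = n.+1%:R -> `|f x * pdf x| <= 2 * C * K / n.+1%:R.
  move=> xn; have x2 : x ^+ 2 = n.+1%:R ^+ 2 by rewrite -xn real_normK // num_real.
  have n1 : (0 : R) < n.+1%:R by rewrite ltr0n.
  have := ger_sqr_normal_pdf x; rewrite -/K x2 => h.
  have p0 := normal_pdf_ge0 0 s x.
  rewrite normrM (ger0_norm p0).
  apply: (@le_trans _ _ (C * (2 * n.+1%:R) * pdf x)).
    rewrite ler_wpM2r //; apply: le_trans (fC x) _; rewrite xn ler_wpM2l //.
    by rewrite mulr_natl mulr2n lerD2r ler1n.
  rewrite ler_pdivlMr //.
  apply: le_trans (ler_wpM2l _ h); last by rewrite mulr_ge0.
  by rewrite le_eqVlt; apply/orP; left; apply/eqP; move: n.+1%:R (pdf x) => a b; ring.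
apply: norm_cvg0; apply: (@squeeze_cvgr _ _ _ _ (fun=> 0)
    (fun n => s ^+ 2 * (2 * (2 * C * K)) * harmonic n)).
- apply: nearW => n; rewrite normr_ge0 /= normrM (ger0_norm (ltW s2)).
  have h1 := bnd n n.+1%:R (ger0_norm (ler0n _ _)).
  have h2 : `|f (- n.+1%:R) * pdf (- n.+1%:R)| <= 2 * C * K / n.+1%:R.
    by apply: bnd; rewrite normrN ger0_norm.
  have h3 := le_trans (ler_normB _ _) (lerD h1 h2).
  apply: le_trans (ler_wpM2l (ltW s2) h3) _.
  by rewrite le_eqVlt; apply/orP; left; apply/eqP => /=; move: (n.+1%:R^-1) => h; ring.
- exact: cvg_cst.
- rewrite -[X in _ --> X](mulr0 (s ^+ 2 * (2 * (2 * C * K)))).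
  by apply: cvgM; [exact: cvg_cst|exact: cvg_harmonic].
Qed.

Lemma itv_natS_cover (x : R) : \forall n \near \oo, x \in `[(- n.+1%:R)%R, n.+1%:R].
Proof.
near=> n; rewrite in_itv /= -ler_norml.
have : `|x| <= n%:R by near: n; exact: nbhs_infty_ger.
by move=> h; apply: le_trans h _; rewrite ler_nat.
Unshelve. all: by end_near. Qed.

(** The growth bound makes the boundary terms of the truncated integrals vanish,
    and dominated convergence removes the truncation. *)
Lemma normal_stein (f f' : R -> R) (C : R) :
  (forall x : R, is_derive x (1 : R) f (f' x)) -> continuous f' ->
  (forall x, `|f x| <= C * (1 + `|x|)) ->
  N.-integrable setT (fun x => (s ^+ 2 * f' x - x * f x)%:E) ->
  (\int[N]_x (s ^+ 2 * f' x - x * f x)%:E = 0)%E.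
Proof.
move=> df cf' fC gint.
set g := (fun x => _) in gint *.
pose A n : set (measurableTypeR R) := `[(- n.+1%:R)%R, n.+1%:R]%classic.
have mg := measurable_int _ gint.
have mA n : measurable (A n) by exact: measurable_itv.
have h1 n : measurable_fun (setT : set (measurableTypeR R)) (g \_ (A n)).
  have mgn := measurable_funTS (D := A n) mg.
  have h := (measurable_restrictT g (mA n)).1 mgn.
  exact: h.
have h2 : {ae N, forall x, setT x -> (g \_ (A n)) x @[n --> \oo] --> g x}.
  apply: aeW => x _; apply: cvg_near_cst.
  near=> n; rewrite patchE mem_set //= /A.
  by near: n; exact: itv_natS_cover.
have h3 : {ae N, forall x n, setT x -> (`|(g \_ (A n)) x| <= `|g x|)%E}.
  by apply: aeW => x n _; rewrite patchE; case: ifP => // _; rewrite abse0.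
have [_ _ cvg1] := dominated_convergence measurableT h1 mg h2 (integrable_abse gint) h3.
have cvg2 : (fun n => \int[N]_x (g \_ (A n)) x)%E @ \oo --> (0 : \bar R)%E.
  apply: (@cvg_trans _ (EFin \o (fun n => s ^+ 2 * (f n.+1%:R * pdf n.+1%:R -
      f (- n.+1%:R) * pdf (- n.+1%:R))) @ \oo)); last first.
    by apply: cvg_EFin; [exact: nearW|exact: cvg_boundary_normal fC].
  apply: near_eq_cvg; apply: nearW => n /=.
  by rewrite -integral_mkcond /A integral_normal_itv.
exact: (cvg_unique _ cvg1 cvg2).
Unshelve. all: by end_near. Qed.

(** In the integration by parts for [f x = x] on a symmetric interval the boundary
    term is nonnegative, so the truncated second moments never exceed [s^2]. *)
Lemma normal_sqr_integrable : N.-integrable setT (fun x => (x ^+ 2)%:E).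
Proof.
have msq : measurable_fun setT (fun x : R => (x ^+ 2)%:E).
  by apply/measurable_EFinP; exact: exprn_measurable.
pose A n : set (measurableTypeR R) := `[(- n.+1%:R)%R, n.+1%:R]%classic.
have mA n : measurable (A n) by exact: measurable_itv.
have cvg1 : (fun n => \int[N]_(x in A n) (x ^+ 2)%:E)%E @ \oo -->
    (\int[N]_(x in \bigcup_n A n) (x ^+ 2)%:E)%E.
  apply: ge0_nondecreasing_set_cvg_integral => //.
  - apply/nondecreasing_seqP => n; rewrite subsetEset => x; rewrite /A /= !in_itv /=.
    rewrite -!ler_norml => h; apply: le_trans h _; by rewrite ler_nat.
  - by move=> n; exact: measurable_funTS.
  - by move=> n x _; rewrite lee_fin sqr_ge0.
have UA : \bigcup_n A n = setT.
  apply/seteqP; split=> // x _.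
  by have [n _ h] := itv_natS_cover x; exists n => //; exact: (h n (leqnn n)).
rewrite UA in cvg1.
have le n : (\int[N]_(x in A n) (x ^+ 2)%:E <= (s ^+ 2)%:E)%E.
  have e : (\int[N]_(x in A n) (s ^+ 2 * 1 - x * x)%:E =
      (s ^+ 2 * (n.+1%:R * pdf n.+1%:R - (- n.+1%:R) * pdf (- n.+1%:R)))%:E)%E.
    apply: (@integral_normal_itv idfun (fun=> 1) n.+1).
    by move=> x; exact: cvg_cst.
  have i1 : N.-integrable (A n) (fun x => (x ^+ 2)%:E).
    apply: continuous_itv_integrable_normal => x; exact: exprn_continuous.
  have i2 : N.-integrable (A n) (fun=> (s ^+ 2)%:E).
    by apply: continuous_itv_integrable_normal => x; exact: cvg_cst.
  have e2 : (\int[N]_(x in A n) (s ^+ 2 * 1 - x * x)%:E =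
      (s ^+ 2)%:E * N (A n) - \int[N]_(x in A n) (x ^+ 2)%:E)%E.
    rewrite -(integral_cst N (mA n)).
    rewrite -(integralB (mA n) i2 i1).
    by apply: eq_integral => x _; rewrite mulr1 -expr2 EFinB.
  have b0 : (0 <= (s ^+ 2)%:E * N (A n) - \int[N]_(x in A n) (x ^+ 2)%:E)%E.
    rewrite -e2 e lee_fin mulr_ge0 ?sqr_ge0 // mulNr opprK.
    by rewrite addr_ge0 // mulr_ge0 // normal_pdf_ge0.
  have fin : (\int[N]_(x in A n) (x ^+ 2)%:E)%E \is a fin_num.
    exact: (integrable_fin_num (mA n) i1).
  rewrite sube_ge0 in b0; last by rewrite fin.
  apply: le_trans b0 _; rewrite -[leRHS]mule1 lee_wpmul2l ?lee_fin ?sqr_ge0 //.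
  exact: probability_le1.
apply/integrableP; split => //.
under eq_integral do rewrite gee0_abs ?lee_fin ?sqr_ge0 //.
apply: (@le_lt_trans _ _ (s ^+ 2)%:E); last exact: ltry.
rewrite -(cvg_lim _ cvg1) //; apply: lime_le; last exact: nearW.
by apply/cvg_ex; eexists; exact: cvg1.
Qed.

Lemma integral_normal_sqr : (\int[N]_x (x ^+ 2)%:E = (s ^+ 2)%:E)%E.
Proof.
have i2 : N.-integrable setT (fun=> (s ^+ 2)%:E) by exact: finite_measure_integrable_cst.
have i1 := normal_sqr_integrable.
have e : (\int[N]_x (s ^+ 2 * 1 - x * x)%:E = 0)%E.
  apply: (@normal_stein idfun (fun=> 1) 1).
  - by move=> x; exact: cvg_cst.
  - by move=> x; rewrite mul1r lerDr.
  - have -> : (fun x : R => (s ^+ 2 * 1 - x * x)%:E) =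
        (fun x => (s ^+ 2)%:E - (x ^+ 2)%:E)%E.
      by apply/funext => x; rewrite mulr1 -expr2 EFinB.
    exact: (integrableB measurableT i2 i1).
have e2 : (\int[N]_x (s ^+ 2 * 1 - x * x)%:E =
    (s ^+ 2)%:E - \int[N]_x (x ^+ 2)%:E)%E.
  rewrite -[in RHS](mule1 (s ^+ 2)%:E) -(probability_setT N) -(integral_cst N measurableT).
  rewrite -(integralB measurableT i2 i1).
  by apply: eq_integral => x _; rewrite mulr1 -expr2 EFinB.
have fin := integrable_fin_num measurableT i1.
move: e; rewrite e2 => /eqP; rewrite sube_eq ?fin_num_adde_defl // add0e => /eqP <-.
by [].
Qed.

End NormalIntegrationByParts.

(** * Measurability of matrix-valued maps *)

Lemma enorm_sqrE {R : realType} k (v : 'cV[R]_k) : enorm v ^+ 2 = \sum_i v i 0 ^+ 2.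
Proof.
by rewrite /enorm sqr_sqrtr //; apply: sumr_ge0 => i _; exact: sqr_ge0.
Qed.

Section MeasurableMatrices.
Context {R : realType} d (T : measurableType d).

Lemma measurable_invr : measurable_fun setT (fun x : R => x^-1).
Proof.
have -> : [set: R] = [set 0] `|` ~` [set 0] by rewrite setUv.
apply/measurable_funU => //; first exact: measurableC.
split; first exact: measurable_fun_set1.
apply: open_continuous_measurable_fun; first by apply: closed_openC; apply: compact_closed; [exact: Rhausdorff|exact: compact_set1].
by move=> x; rewrite inE /= => /eqP x0; exact: inv_continuous.
Qed.

Definition measurable_mx m n (M : T -> 'M[R]_(m, n)) : Prop :=
  forall i j, measurable_fun setT (fun w => M w i j).

Lemma measurable_prod_fun (I : Type) (r : seq I) (Q : pred I) (F : I -> T -> R) :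
  (forall i, measurable_fun setT (F i)) ->
  measurable_fun setT (fun w => \prod_(i <- r | Q i) F i w).
Proof.
move=> mF; elim: r => [|i r IH].
  by under eq_fun do rewrite big_nil; exact: measurable_cst.
under eq_fun do rewrite big_cons.
by case: (Q i) => //; apply: measurable_funM.
Qed.

Lemma measurable_sum_fun (I : Type) (r : seq I) (Q : pred I) (F : I -> T -> R) :
  (forall i, measurable_fun setT (F i)) ->
  measurable_fun setT (fun w => \sum_(i <- r | Q i) F i w).
Proof.
move=> mF; elim: r => [|i r IH].
  by under eq_fun do rewrite big_nil; exact: measurable_cst.
under eq_fun do rewrite big_cons.
by case: (Q i) => //; apply: measurable_funD.
Qed.

Lemma measurable_mx_cst m n (A : 'M[R]_(m, n)) : measurable_mx (fun=> A).
Proof. by move=> i j; exact: measurable_cst. Qed.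

Lemma measurable_mxD m n (A B : T -> 'M[R]_(m, n)) :
  measurable_mx A -> measurable_mx B -> measurable_mx (fun w => A w + B w).
Proof.
by move=> mA mB i j; under eq_fun do rewrite mxE; exact: measurable_funD.
Qed.

Lemma measurable_mxB m n (A B : T -> 'M[R]_(m, n)) :
  measurable_mx A -> measurable_mx B -> measurable_mx (fun w => A w - B w).
Proof.
move=> mA mB i j; under eq_fun do rewrite !mxE.
by apply: measurable_funB.
Qed.

Lemma measurable_mxT m n (A : T -> 'M[R]_(m, n)) :
  measurable_mx A -> measurable_mx (fun w => (A w)^T).
Proof. by move=> mA i j; under eq_fun do rewrite mxE; exact: mA. Qed.

Lemma measurable_mxM m n p (A : T -> 'M[R]_(m, n)) (B : T -> 'M[R]_(n, p)) :
  measurable_mx A -> measurable_mx B -> measurable_mx (fun w => A w *m B w).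
Proof.
move=> mA mB i j; under eq_fun do rewrite mxE.
by apply: measurable_sum_fun => k; exact: measurable_funM.
Qed.

Lemma measurable_det n (A : T -> 'M[R]_n) :
  measurable_mx A -> measurable_fun setT (fun w => \det (A w)).
Proof.
move=> mA; rewrite /determinant; apply: measurable_sum_fun => p.
by apply: measurable_funM => //; exact: measurable_prod_fun.
Qed.

Lemma measurable_tr n (A : T -> 'M[R]_n) :
  measurable_mx A -> measurable_fun setT (fun w => \tr (A w)).
Proof. by move=> mA; rewrite /mxtrace; exact: measurable_sum_fun. Qed.

Lemma measurable_invmx n (A : T -> 'M[R]_n) :
  measurable_mx A -> measurable_mx (fun w => invmx (A w)).
Proof.
move=> mA i j; have mdet := measurable_det mA.
have -> : (fun w => invmx (A w) i j) = (fun w => if \det (A w) != 0 then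
    (\det (A w))^-1 * \adj (A w) i j else A w i j).
  by apply/funext => w; rewrite /invmx unitmxE unitfE; case: ifP => _; rewrite ?mxE.
apply: measurable_fun_ifT => //.
- apply: (measurableT_comp (f := fun x : R => x != 0)) => //.
  by apply: measurable_neg; exact: measurable_fun_eqr.
- apply: measurable_funM; first exact: measurableT_comp measurable_invr mdet.
  under eq_fun do rewrite mxE /cofactor.
  apply: measurable_funM => //; apply: measurable_det => k l.
  by under eq_fun do rewrite !mxE; exact: mA.
Qed.

Lemma measurable_enorm_sqr k (v : T -> 'cV[R]_k) :
  measurable_mx v -> measurable_fun setT (fun w => enorm (v w) ^+ 2).
Proof.
move=> mv; under eq_fun do rewrite enorm_sqrE.
by apply: measurable_sum_fun => i; apply: measurable_funX; exact: mv.
Qed.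

Lemma measurable_dotv k (u v : T -> 'cV[R]_k) :
  measurable_mx u -> measurable_mx v ->
  measurable_fun setT (fun w => dotv (u w) (v w)).
Proof.
by move=> mu mv; apply: measurable_sum_fun => i; apply: measurable_funM;
  [exact: mu|exact: mv].
Qed.

End MeasurableMatrices.

(** * Quadratic forms under sign changes *)

Section EvenQuadratic.
Context {R : realType} d (T : measurableType d) (P : probability T R).
Variable I : finType.

Definition flip (i : I) (v : I -> R) : I -> R := fun j => if j == i then - v j else v j.
Definition erase (i : I) (v : I -> R) : I -> R := fun j => if j == i then 0 else v j.

Lemma ge0_half_double (x : \bar R) : (0 <= x)%E -> ((2^-1)%:E * (x + x) = x)%E.
Proof.
case: x => [r _|_|//]; first by rewrite -EFinD -EFinM; congr EFin; field.
by rewrite addey // gt0_muley // lte_fin invr_gt0.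
Qed.

(** The parallelogram law turns invariance under a change of sign of one
    coordinate into orthogonality to that coordinate; since only nonnegative
    integrals are added, no moment has to be finite. *)
Lemma integral_even_quadratic (q : T -> (I -> R) -> R) (p : I -> T -> R) (v : I -> R) :
  (forall w u, 0 <= q w u) -> (forall i w, 0 <= p i w) ->
  (forall u, measurable_fun setT (q^~ u)) ->
  (forall i, measurable_fun setT (p i)) ->
  (forall w u i, q w u + q w (flip i u) =
     2 * (q w (erase i u) + u i ^+ 2 * p i w)) ->
  (forall u i, \int[P]_w (q w (flip i u))%:E = \int[P]_w (q w u)%:E)%E ->
  (\int[P]_w (q w v)%:E = \int[P]_w (q w (fun=> 0))%:E +
     \sum_i (v i ^+ 2)%:E * \int[P]_w (p i w)%:E)%E.
Proof.
move=> q0 p0 mq mp pl inv.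
suff h (r : seq I) : uniq r ->
    (\int[P]_w (q w (fun i => if i \in r then v i else 0))%:E =
     \int[P]_w (q w (fun=> 0))%:E +
     \sum_(i <- r) (v i ^+ 2)%:E * \int[P]_w (p i w)%:E)%E.
  have := h (index_enum I) (index_enum_uniq I).
  by have -> : (fun i => if i \in index_enum I then v i else 0) = v
    by apply/funext => i; rewrite mem_index_enum.
elim: r => [_|i r IH /= /andP[ir ur]]; first by rewrite big_nil adde0.
set u := (fun j => if j \in i :: r then v j else 0).
have ui : u i = v i by rewrite /u mem_head.
have eu : erase i u = (fun j => if j \in r then v j else 0).
  apply/funext => j; rewrite /erase /u in_cons; case: eqP => //= ->.
  by rewrite (negbTE ir).
have mE (f : T -> R) : measurable_fun setT f -> measurable_fun setT (EFin \o f).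
  by move=> mf; apply/measurable_EFinP.
have pos w x : (0 <= (q w x)%:E)%E by rewrite lee_fin.
(* Averaging over both signs of the coordinate [i]. *)
rewrite -[LHS]ge0_half_double; last by apply: integral_ge0.
rewrite -{2}(inv u i) -ge0_integralD //; [|by [exact: mE|move=> w _; exact: pos]..].
rewrite -ge0_integralZl //; last 2 first.
- by apply: emeasurable_funD; exact: mE.
- by move=> w _; rewrite adde_ge0.
transitivity (\int[P]_w ((q w (erase i u))%:E + (v i ^+ 2)%:E * (p i w)%:E))%E.
  apply: eq_integral => w _; rewrite -EFinD pl -!EFinM -EFinD; congr EFin.
  by rewrite mulrA mulVf ?mul1r ?ui // pnatr_eq0.
have pp w : (0 <= (v i ^+ 2)%:E * (p i w)%:E)%E by rewrite mule_ge0 ?lee_fin ?sqr_ge0.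
rewrite ge0_integralD //; last 2 first.
- exact: mE.
- by apply: emeasurable_funM => //; exact: mE.
rewrite ge0_integralZl //; [|exact: mE|by move=> w _; rewrite lee_fin|by rewrite lee_fin sqr_ge0].
rewrite eu IH // big_cons -addeA; congr (_ + _)%E; exact: addeC.
Qed.

End EvenQuadratic.

(** * Integration over one coordinate of a normal family *)

Lemma integral_prob_cst {R : realType} d (T : measurableType d) (P : probability T R)
  (k : \bar R) : (\int[P]_w k = k)%E.
Proof. by rewrite integral_cst // [X in (_ * X)%E](probability_setT P) mule1. Qed.

Section Coordinates.
Context {R : realType} {I : finType} (s : I -> R) d (T : measurableType d)
  (P : probability T R) (Z : T -> I -> R).
Hypotheses (s0 : forall i, s i != 0) (hZ : indep_normal s P Z).

Lemma coord_law i (B : set R) : measurable B ->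
  P ((fun w => Z w i) @^-1` B) = normal_prob 0 (s i) B.
Proof.
move=> mB; pose B' j := if j == i then B else setT.
have := hZ.2 B'; rewrite (big_mule_support (A := pred1 i)); last first.
  by move=> j /= /negbTE ji; rewrite /B' ji probability_setT.
have B'i : B' i = B by rewrite /B' eqxx.
rewrite big_pred1_eq B'i => <-; last first.
  by move=> j; rewrite /B'; case: ifP.
congr (P _); apply/seteqP; split=> w /= h.
  by move=> j; rewrite /B'; case: eqP => // ->.
by move: (h i); rewrite /B' eqxx.
Qed.

Lemma ge0_integral_coord i (g : R -> \bar R) :
  measurable_fun setT g -> (forall x, 0 <= g x)%E ->
  (\int[P]_w g (Z w i) = \int[normal_prob 0 (s i)]_x g x)%E.
Proof.
move=> mg g0.
pose Zi : T -> measurableTypeR R := fun w => Z w i.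
have mZi : measurable_fun setT Zi by exact: (hZ.1 i).
have mg' : measurable_fun (setT : set (measurableTypeR R)) g by exact: mg.
rewrite -[LHS](ge0_integral_pushforward mZi P measurableT mg' (fun x _ => g0 x)).
by apply: eq_measure_integral => A mA _; exact: coord_law.
Qed.

Lemma integral_coord_sqr i : (\int[P]_w (Z w i ^+ 2)%:E = (s i ^+ 2)%:E)%E.
Proof.
rewrite (@ge0_integral_coord i (fun x => (x ^+ 2)%:E)).
- exact: integral_normal_sqr.
- by apply/measurable_EFinP; exact: exprn_measurable.
- by move=> x; rewrite lee_fin sqr_ge0.
Qed.

Lemma integral_coord i (g : R -> R) : measurable_fun setT g ->
  (normal_prob 0 (s i)).-integrable setT (EFin \o g) ->
  P.-integrable setT (fun w => (g (Z w i))%:E) /\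
  (\int[P]_w (g (Z w i))%:E = \int[normal_prob 0 (s i)]_x (g x)%:E)%E.
Proof.
move=> mg gint.
pose Zi : T -> measurableTypeR R := fun w => Z w i.
have mZi : measurable_fun setT Zi by exact: (hZ.1 i).
have mg' : measurable_fun (setT : set (measurableTypeR R)) (EFin \o g).
  by apply/measurable_EFinP; exact: mg.
have int : P.-integrable setT (fun w => (g (Z w i))%:E).
  apply/integrableP; split.
    by apply/measurable_EFinP; exact: measurableT_comp mg (hZ.1 i).
  have /integrableP[_] := gint; congr (_ < _)%E; apply/esym.
  rewrite -(@ge0_integral_coord i (fun x => `|(g x)%:E|%E)) //.
  by apply: measurableT_comp => //; apply/measurable_EFinP.
split => //.
rewrite -[LHS](integral_pushforward mZi mg' int measurableT).
by apply: eq_measure_integral => A mA _; exact: coord_law.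
Qed.

(** Changing the sign of one variable preserves the law, so the cross terms cancel
    as in [integral_even_quadratic]. *)
Lemma integral_affine_sqr (c : R) (a : I -> R) :
  (\int[P]_w ((c + \sum_i a i * Z w i) ^+ 2)%:E =
   (c ^+ 2 + \sum_i a i ^+ 2 * s i ^+ 2)%:E)%E.
Proof.
have mZ := hZ.1.
pose q c' w (v : I -> R) := (c' + \sum_i v i * Z w i) ^+ 2.
have mq c' v : measurable_fun setT (q c' ^~ v).
  apply: measurable_funX; apply: measurable_funD => //.
  by apply: measurable_sum_fun => i; apply: measurable_funM.
rewrite (@integral_even_quadratic _ _ _ P _ (q c) (fun i w => Z w i ^+ 2) a) //.
- under eq_integral => w _.
    rewrite /q [X in c + X]big1 ?addr0; last by move=> i _; rewrite mul0r.
    over.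
  rewrite integral_prob_cst EFinD; congr (_ + _)%E.
  rewrite -sumEFin.
  by apply: eq_bigr => i _; rewrite integral_coord_sqr EFinM.
- by move=> w u; exact: sqr_ge0.
- by move=> i w; exact: sqr_ge0.
- by move=> i; apply: measurable_funX.
- move=> w u i; rewrite /q (bigD1 i) //= (bigD1 i (P := xpredT)) //=.
  rewrite [in RHS](bigD1 i) //= /flip /erase eqxx mul0r add0r.
  have e1 : \sum_(j | j != i) (if j == i then - u j else u j) * Z w j =
      \sum_(j | j != i) u j * Z w j.
    by apply: eq_bigr => j /negbTE ->.
  have e2 : \sum_(j | j != i) (if j == i then 0 else u j) * Z w j =
      \sum_(j | j != i) u j * Z w j.
    by apply: eq_bigr => j /negbTE ->.
  by rewrite e1 e2; ring.
- move=> u i.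
  pose f (z : family R I) : \bar R := ((c + \sum_j u j * z j) ^+ 2)%:E.
  have mf : measurable_fun setT f.
    apply/measurable_EFinP; apply: measurable_funX; apply: measurable_funD => //.
    apply: measurable_sum_fun => j; apply: measurable_funM => //.
    exact: measurable_coord.
  have f0 z : (0 <= f z)%E by rewrite lee_fin sqr_ge0.
  have := ge0_integral_same_law (indep_normal_sign (pred1 i) s0 hZ) hZ mf f0.
  rewrite /f /q => <-; apply: eq_integral => w _; congr (_ ^+ 2)%:E; congr (_ + _).
  apply: eq_bigr => j _; rewrite /flip /=; case: eqP => _; rewrite ?mul1r //.
  by rewrite expr1 mulN1r mulrN mulNr.
Qed.

Definition update (i : I) (z : I -> R) (t : R) : I -> R :=
  fun j => if j != i then z j else t.

Lemma updateE i z t : update i z t i = t. Proof. by rewrite /update eqxx. Qed.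

(** The coordinate [i] is replaced by an independent copy and integrated first,
    where [normal_stein] applies. Adding a quadratic majorant of the integrand makes
    it nonnegative, so that Tonelli is enough for the exchange. *)
Lemma stein_coord i (h h' : family R I -> R) (C : R) :
  measurable_fun setT h -> measurable_fun setT h' ->
  (forall (z : family R I) (t : R),
     is_derive t (1 : R) (fun t => h (update i z t)) (h' (update i z t))) ->
  (forall z : family R I, continuous (fun t : R => h' (update i z t))) ->
  (forall z, `|h z| <= C) -> (forall z, `|h' z| <= C) ->
  P.-integrable setT (fun w => (s i ^+ 2 * h' (Z w) - Z w i * h (Z w))%:E) /\
  (\int[P]_w (s i ^+ 2 * h' (Z w) - Z w i * h (Z w))%:E = 0)%E.
Proof.
move=> mh mh' dh ch' hC h'C.
have C0 : 0 <= C by apply: le_trans (hC (fun=> 0)).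
pose F (z : family R I) := s i ^+ 2 * h' z - z i * h z.
(* [|x| <= 1 + x^2] turns the linear growth of the integrand into this majorant. *)
pose g (x : R) := s i ^+ 2 * C + C * (1 + x ^+ 2).
have Fg z : `|F z| <= g (z i).
  apply: le_trans (ler_normB _ _) _; apply: lerD.
    by rewrite normrM (ger0_norm (sqr_ge0 _)) ler_wpM2l ?sqr_ge0.
  rewrite normrM mulrC ler_pM //.
  have := sqr_ge0 (`|z i| - 1); have := normr_ge0 (z i).
  rewrite sqrrB1 -[in X in _ -> _ -> _ <= X]real_normK ?num_real //; nra.
have g0 x : 0 <= g x.
  by rewrite addr_ge0 // mulr_ge0 ?sqr_ge0 // addr_ge0 ?sqr_ge0.
have mF : measurable_fun setT F.
  apply: measurable_funB; first exact: measurable_funM.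
  by apply: measurable_funM => //; exact: measurable_coord.
have mg : measurable_fun setT g.
  apply: measurable_funD => //; apply: measurable_funM => //.
  by apply: measurable_funD => //; exact: exprn_measurable.
have gN : (normal_prob 0 (s i)).-integrable setT (EFin \o g).
  have -> : EFin \o g = (fun x : R => (s i ^+ 2 * C + C)%:E + C%:E * (x ^+ 2)%:E)%E.
    by apply/funext => x; rewrite /= -EFinM -EFinD /g mulrDr mulr1 addrA.
  apply: integrableD => //; first exact: finite_measure_integrable_cst.
  by apply: integrableZl => //; exact: normal_sqr_integrable.
have [gP gE] := integral_coord mg gN.
have mFZ : measurable_fun setT (fun w => (F (Z w))%:E).
  by apply/measurable_EFinP; apply: (measurableT_comp mF); exact: measurable_family hZ.1.
have FP : P.-integrable setT (fun w => (F (Z w))%:E).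
  apply: (le_integrable measurableT _ _ gP) => // w _ /=.
  by rewrite lee_fin (ger0_norm (g0 _)).
split => //.
pose G (z : family R I) : \bar R := (F z + g (z i))%:E.
have mgi : measurable_fun setT (fun z : family R I => g (z i)).
  by apply: (measurableT_comp mg); exact: measurable_coord.
have mG : measurable_fun setT G by apply/measurable_EFinP; exact: measurable_funD.
have G0 z : (0 <= G z)%E.
  have := Fg z; rewrite ler_norml lee_fin => /andP[+ _]; lra.
have inner w1 : (\int[P]_w2 G (fun j => if j != i then Z w1 j else Z w2 j) =
    \int[normal_prob 0 (s i)]_x (g x)%:E)%E.
  pose k (t : R) := F (update i (Z w1) t).
  have kE : k = fun t => s i ^+ 2 * h' (update i (Z w1) t) - t * h (update i (Z w1) t).
    by apply/funext => t; rewrite /k /F updateE.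
  have ch : continuous (fun t : R => h (update i (Z w1) t)).
    by move=> t; apply/differentiable_continuous/derivable1_diffP; case: (dh (Z w1) t).
  have ck : continuous k.
    rewrite kE => t; apply: cvgB; apply: cvgM.
    - exact: cvg_cst.
    - exact: ch'.
    - exact: cvg_id.
    - exact: ch.
  have mk : measurable_fun setT k by exact: continuous_measurable_fun.
  have kN : (normal_prob 0 (s i)).-integrable setT (EFin \o k).
    apply: (le_integrable measurableT _ _ gN) => //=.
      by apply/measurable_EFinP; exact: mk.
    move=> t _; rewrite lee_fin (ger0_norm (g0 _)).
    by have := Fg (update i (Z w1) t); rewrite updateE.
  have [kP kI] := integral_coord mk kN.
  have k0 : (\int[normal_prob 0 (s i)]_x (k x)%:E = 0)%E.
    have kN' := kN; rewrite kE in kN' *.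
    apply: (normal_stein (s0 i) (C := C) (dh (Z w1)) (ch' (Z w1))) => // x.
    apply: le_trans (hC _) _; by rewrite mulrDr mulr1 lerDl mulr_ge0.
  transitivity (\int[P]_w ((k (Z w i))%:E + (g (Z w i))%:E))%E.
    apply: eq_integral => w _.
    have -> : (fun j => if j != i then Z w1 j else Z w j) = update i (Z w1) (Z w i).
      by apply/funext => j; rewrite /update; case: eqP => // ->.
    by rewrite /G updateE.
  by rewrite (integralD measurableT kP gP) kI k0 add0e gE.
have tot : (\int[P]_w G (Z w) = \int[normal_prob 0 (s i)]_x (g x)%:E)%E.
  rewrite (ge0_integral_mix (predC1 i) hZ hZ mG G0) /=.
  under eq_integral do rewrite inner.
  exact: integral_prob_cst.
have tot2 : (\int[P]_w G (Z w) = \int[P]_w (F (Z w))%:E + \int[P]_w (g (Z w i))%:E)%E.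
  rewrite -(integralD measurableT FP gP); by apply: eq_integral => w _; rewrite -EFinD.
have gfin := integrable_fin_num measurableT gP.
move: tot2; rewrite tot -gE.
move=> /(congr1 (fun x => x - \int[P]_w (g (Z w i))%:E)%E).
by rewrite subee // addeK // => <-.
Qed.

End Coordinates.

(** * The regularized Gram matrix *)

Section RegularizedGram.
Context {R : realType} (p q : nat).
Implicit Types (G : 'M[R]_(p, q)) (eps : R).

(** With [S = G G^T + eps], these are [S], its inverse [Y], the solution [B = Y G],
    and the ridge hat matrix [H = G^T Y G]. A positive [eps] makes them smooth and
    bounded functions of [G], as integration by parts requires. *)
Definition rgram eps G : 'M[R]_p := G *m G^T + eps%:M.
Definition rinv eps G : 'M[R]_p := invmx (rgram eps G).
Definition rsolve eps G : 'M[R]_(p, q) := rinv eps G *m G.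
Definition rhat eps G : 'M[R]_q := G^T *m rsolve eps G.

Lemma mxdiag_mulT m n (A : 'M[R]_(m, n)) i : (A *m A^T) i i = \sum_j A i j ^+ 2.
Proof. by rewrite mxE; apply: eq_bigr => j _; rewrite mxE expr2. Qed.

Lemma mxtrace_mulT m n (A : 'M[R]_(m, n)) :
  \tr (A *m A^T) = \sum_i \sum_j A i j ^+ 2.
Proof. by apply: eq_bigr => i _; exact: mxdiag_mulT. Qed.

Lemma rgram_sym eps G : (rgram eps G)^T = rgram eps G.
Proof. by rewrite /rgram linearD /= trmx_mul trmxK tr_scalar_mx. Qed.

Lemma rinv_sym eps G : (rinv eps G)^T = rinv eps G.
Proof. by rewrite /rinv trmx_inv rgram_sym. Qed.

Lemma rgram_unit eps G : 0 < eps -> rgram eps G \in unitmx.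
Proof.
move=> e0; rewrite -row_free_unit; apply: inj_row_free => v vS.
have h : (v *m G *m (v *m G)^T) 0 0 + eps * (v *m v^T) 0 0 = 0.
  have : (v *m rgram eps G *m v^T) 0 0 = 0 by rewrite vS mul0mx mxE.
  rewrite /rgram mulmxDr mulmxDl mxE => <-; rewrite trmx_mul !mulmxA.
  by rewrite mul_mx_scalar -scalemxAl; congr (_ + _); rewrite [RHS]mxE.
move: h; rewrite !mxdiag_mulT => h.
have s1 : 0 <= \sum_j (v *m G) 0 j ^+ 2 by apply: sumr_ge0 => j _; exact: sqr_ge0.
have s2 : 0 <= \sum_j v 0 j ^+ 2 by apply: sumr_ge0 => j _; exact: sqr_ge0.
have s3 : \sum_j v 0 j ^+ 2 = 0.
  apply/eqP; rewrite eq_le s2 andbT -(pmulr_rle0 _ e0) -[leRHS]h lerDr; exact: s1.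
apply/matrixP => i j; rewrite (ord1 i) [RHS]mxE; apply/eqP; rewrite -sqrf_eq0; apply/eqP.
by apply: (psumr_eq0P _ s3) => // k _; exact: sqr_ge0.
Qed.

Section Bounds.
Variables (eps : R) (G : 'M[R]_(p, q)).
Hypothesis e0 : 0 < eps.
Local Notation Y := (rinv eps G).
Local Notation B := (rsolve eps G).
Local Notation H := (rhat eps G).

(** This is [Y S Y = Y] with [S] expanded; its diagonal bounds [Y] and [B]. *)
Lemma rinvE : Y = B *m B^T + eps *: (Y *m Y^T).
Proof.
have -> : B *m B^T + eps *: (Y *m Y^T) = Y *m rgram eps G *m Y^T.
  rewrite /rsolve trmx_mul /rgram mulmxDr mulmxDl !mulmxA; congr (_ + _).
  by rewrite mul_mx_scalar scalemxAl.
by rewrite /rinv mulVmx ?rgram_unit // mul1mx rinv_sym.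
Qed.

Lemma rhat_sym : H^T = H.
Proof. by rewrite /rhat /rsolve !trmx_mul trmxK rinv_sym mulmxA. Qed.

(** This is [G^T Y S Y G = H] with [S] expanded; its diagonal gives [H^2 <= H], hence
    a diagonal between 0 and 1. *)
Lemma rhatE : H = H *m H^T + eps *: (B^T *m B).
Proof.
rewrite rhat_sym; have -> : H *m H + eps *: (B^T *m B) =
    G^T *m Y *m rgram eps G *m Y *m G.
  rewrite /rhat /rsolve trmx_mul rinv_sym /rgram mulmxDr !mulmxDl !mulmxA.
  by congr (_ + _); rewrite mul_mx_scalar -!scalemxAl.
by rewrite -[G^T *m Y *m _]mulmxA /rinv mulVmx ?rgram_unit // mulmx1 /rhat /rsolve mulmxA.
Qed.

Lemma rinv_diagE i : Y i i = \sum_j B i j ^+ 2 + eps * \sum_k Y i k ^+ 2.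
Proof. by rewrite {1}rinvE mxE mxdiag_mulT [X in _ + X]mxE mxdiag_mulT. Qed.

Lemma rhat_diagE j : H j j = \sum_k H j k ^+ 2 + eps * \sum_i B i j ^+ 2.
Proof.
rewrite {1}rhatE mxE mxdiag_mulT [X in _ + X]mxE -{2}[B]trmxK mxdiag_mulT.
by congr (_ + _ * _); apply: eq_bigr => i _; rewrite mxE.
Qed.

Lemma sum_sqr_ge n (f : 'I_n -> R) k : f k ^+ 2 <= \sum_i f i ^+ 2.
Proof.
by rewrite (bigD1 k) //= lerDl; apply: sumr_ge0 => i _; exact: sqr_ge0.
Qed.

Lemma rinv_diag_ge0 i : 0 <= Y i i.
Proof.
rewrite rinv_diagE addr_ge0 ?mulr_ge0 ?(ltW e0) //; apply: sumr_ge0 => j _;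
  exact: sqr_ge0.
Qed.

Lemma rinv_diag_le i : Y i i <= eps^-1.
Proof.
have h : eps * Y i i ^+ 2 <= Y i i.
  rewrite [leRHS]rinv_diagE; have := sum_sqr_ge (Y i) i.
  rewrite -(ler_pM2l e0) => h; apply: le_trans h _; rewrite lerDr.
  by apply: sumr_ge0 => j _; exact: sqr_ge0.
have := rinv_diag_ge0 i; rewrite le_eqVlt => /predU1P[<-|y0].
  by rewrite invr_ge0 ltW.
rewrite -[leRHS]mul1r ler_pdivlMr // -(ler_pM2l y0) mulr1.
by apply: le_trans h; rewrite le_eqVlt; apply/orP; left; apply/eqP; ring.
Qed.

Lemma rsolve_sqr_le i j : B i j ^+ 2 <= eps^-1.
Proof.
apply: le_trans (rinv_diag_le i); rewrite rinv_diagE.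
apply: le_trans (sum_sqr_ge (B i) j) _; rewrite lerDl mulr_ge0 ?(ltW e0) //.
by apply: sumr_ge0 => k _; exact: sqr_ge0.
Qed.

Lemma rhat_diag01 j : 0 <= H j j <= 1.
Proof.
have b0 : 0 <= eps * \sum_i B i j ^+ 2.
  by rewrite mulr_ge0 ?(ltW e0) //; apply: sumr_ge0 => k _; exact: sqr_ge0.
have h0 : 0 <= H j j.
  by rewrite rhat_diagE addr_ge0 //; apply: sumr_ge0 => k _; exact: sqr_ge0.
rewrite h0 /=; have h : H j j ^+ 2 <= H j j.
  rewrite [leRHS]rhat_diagE; apply: le_trans (sum_sqr_ge (H j) j) _.
  by rewrite lerDl.
by rewrite leNgt; apply/negP => h1; move: h; nra.
Qed.

Lemma rsolve_norm_le i j : `|B i j| <= 1 + 3 * eps^-1.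
Proof.
have := rsolve_sqr_le i j; have : 0 < eps^-1 by rewrite invr_gt0.
rewrite -[B i j ^+ 2]real_normK ?num_real //.
by have := normr_ge0 (B i j); nra.
Qed.

(** The derivative of the entry [(i, j)] of [S^-1 G] with respect to the same
    entry of [G], where [S] is the regularized Gram matrix. *)
Definition rsolve_deriv i j : R := Y i i - Y i i * H j j - B i j ^+ 2.

Lemma rsolve_deriv_le i j : `|rsolve_deriv i j| <= 1 + 3 * eps^-1.
Proof.
have := rsolve_sqr_le i j; have : 0 < eps^-1 by rewrite invr_gt0.
have := rinv_diag_le i; have := rinv_diag_ge0 i; have := sqr_ge0 (B i j).
have /andP[] := rhat_diag01 j; rewrite /rsolve_deriv => h0 h1 b0 y0 y1 e1 b1.
have yh : 0 <= Y i i * H j j <= Y i i.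
  by rewrite mulr_ge0 //= -[leRHS]mulr1 ler_wpM2l.
move/andP: yh => [yh0 yh1].
by rewrite ler_norml; apply/andP; split; lra.
Qed.

Lemma tr_rhat : \tr H = p%:R - eps * \tr Y.
Proof.
rewrite /rhat mxtrace_mulC /rsolve -mulmxA.
have -> : Y *m (G *m G^T) = 1%:M - eps *: Y.
  rewrite -[G *m G^T](addrK eps%:M) -/(rgram eps G) mulmxBr mulVmx ?rgram_unit //.
  by rewrite mul_mx_scalar.
by rewrite linearB /= linearZ /= mxtrace1.
Qed.

(** The sum over all entries collapses to traces because [Y (G G^T) = 1 - eps Y]. *)
Lemma rsolve_divergence :
  \sum_i \sum_j (rsolve_deriv i j - G i j * B i j) =
  (q%:R - p%:R - 1) * \tr Y + eps * (\tr Y) ^+ 2 + eps * \tr (Y *m Y)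
    + eps * \tr Y - p%:R.
Proof.
have sB : \sum_i \sum_j B i j ^+ 2 = \tr Y - eps * \tr (Y *m Y).
  have := congr1 mxtrace rinvE.
  by rewrite mxtraceD mxtraceZ rinv_sym mxtrace_mulT => ->; rewrite addrK.
have sG : \sum_i \sum_j G i j * B i j = \tr H.
  rewrite /rhat /mxtrace exchange_big /=; apply: eq_bigr => j _.
  rewrite [RHS]mxE; apply: eq_bigr => i _; congr (_ * _).
  by rewrite mxE.
have sY : \sum_i \sum_(j < q) Y i i = q%:R * \tr Y.
  rewrite /mxtrace mulr_sumr; apply: eq_bigr => i _.
  by rewrite sumr_const card_ord mulr_natl.
have sYH : \sum_i \sum_j Y i i * H j j = \tr Y * \tr H.
  rewrite /mxtrace mulr_suml; apply: eq_bigr => i _; by rewrite mulr_sumr.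
transitivity (\sum_i \sum_(j < q) Y i i - \sum_i \sum_j Y i i * H j j -
    \sum_i \sum_j B i j ^+ 2 - \sum_i \sum_j G i j * B i j).
  by rewrite -!sumrB; apply: eq_bigr => i _; rewrite -!sumrB.
by rewrite sB sG sY sYH tr_rhat; ring.
Qed.

End Bounds.
End RegularizedGram.

(** * Derivatives of matrix-valued curves *)

Section MatrixCalculus.
Context {R : realType}.

Definition derivable_mx m n (M : R -> 'M[R]_(m, n)) (t : R) : Prop :=
  forall a b, derivable (fun u => M u a b) t 1.

Lemma derivable_sum_fun (I : Type) (r : seq I) (Q : pred I) (F : I -> R -> R) t :
  (forall i, derivable (F i) t 1) ->
  derivable (fun u => \sum_(i <- r | Q i) F i u) t 1.
Proof.
move=> dF; elim: r => [|i r IH].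
  have -> : (fun u => \sum_(i <- [::] | Q i) F i u) = cst 0.
    by apply/funext => u; rewrite big_nil.
  exact: derivable_cst.
have -> : (fun u => \sum_(j <- i :: r | Q j) F j u) =
    if Q i then F i \+ (fun u => \sum_(j <- r | Q j) F j u)
    else (fun u => \sum_(j <- r | Q j) F j u).
  by apply/funext => u; rewrite big_cons; case: (Q i).
by case: (Q i); [exact: derivableD (dF i) IH|exact: IH].
Qed.

Lemma derivable_prod_fun (I : Type) (r : seq I) (Q : pred I) (F : I -> R -> R) t :
  (forall i, derivable (F i) t 1) ->
  derivable (fun u => \prod_(i <- r | Q i) F i u) t 1.
Proof.
move=> dF; elim: r => [|i r IH].
  have -> : (fun u => \prod_(i <- [::] | Q i) F i u) = cst 1.
    by apply/funext => u; rewrite big_nil.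
  exact: derivable_cst.
have -> : (fun u => \prod_(j <- i :: r | Q j) F j u) =
    if Q i then F i \* (fun u => \prod_(j <- r | Q j) F j u)
    else (fun u => \prod_(j <- r | Q j) F j u).
  by apply/funext => u; rewrite big_cons; case: (Q i).
by case: (Q i); [exact: derivableM (dF i) IH|exact: IH].
Qed.

Lemma derivable_mxM m n k (A : R -> 'M[R]_(m, n)) (B : R -> 'M[R]_(n, k)) t :
  derivable_mx A t -> derivable_mx B t -> derivable_mx (fun u => A u *m B u) t.
Proof.
move=> dA dB a b.
have -> : (fun u => (A u *m B u) a b) = (fun u => \sum_j A u a j * B u j b).
  by apply/funext => u; rewrite mxE.
by apply: derivable_sum_fun => j; exact: derivableM.
Qed.

Lemma derivable_mxT m n (A : R -> 'M[R]_(m, n)) t :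
  derivable_mx A t -> derivable_mx (fun u => (A u)^T) t.
Proof.
move=> dA a b.
have -> : (fun u => (A u)^T a b) = (fun u => A u b a).
  by apply/funext => u; rewrite mxE.
exact: dA.
Qed.

Lemma derivable_mxD m n (A B : R -> 'M[R]_(m, n)) t :
  derivable_mx A t -> derivable_mx B t -> derivable_mx (fun u => A u + B u) t.
Proof.
move=> dA dB a b.
have -> : (fun u => (A u + B u) a b) = (fun u => A u a b) \+ (fun u => B u a b).
  by apply/funext => u; rewrite mxE.
exact: derivableD.
Qed.

Lemma derivable_det n (A : R -> 'M[R]_n) t :
  derivable_mx A t -> derivable (fun u => \det (A u)) t 1.
Proof.
move=> dA; apply: derivable_sum_fun => s; apply: derivableM.
  exact: derivable_cst.
exact: derivable_prod_fun.
Qed.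

(** Cramer's rule: the entries of the inverse are quotients of polynomials. *)
Lemma derivable_invmx n (A : R -> 'M[R]_n) t :
  (forall u, A u \in unitmx) -> derivable_mx A t ->
  derivable_mx (fun u => invmx (A u)) t.
Proof.
move=> uA dA a b.
have -> : (fun u => invmx (A u) a b) = (fun u => (\det (A u))^-1 * \adj (A u) a b).
  by apply/funext => u; rewrite /invmx uA mxE.
apply: derivableM.
  apply: derivableV; last exact: derivable_det.
  by have := uA t; rewrite unitmxE unitfE.
have -> : (fun u => \adj (A u) a b) = (fun u => cofactor (A u) b a).
  by apply/funext => u; rewrite mxE.
apply: derivableM; first exact: derivable_cst.
apply: derivable_det => k l.
have -> : (fun u => row' b (col' a (A u)) k l) = (fun u => A u (lift b k) (lift a l)).
  by apply/funext => u; rewrite !mxE.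
exact: dA.
Qed.

Definition derive_mx m n (M : R -> 'M[R]_(m, n)) (t : R) : 'M[R]_(m, n) :=
  \matrix_(a, b) 'D_1 (fun u => M u a b) t.

Lemma derive_sum_fun (I : Type) (r : seq I) (F : I -> R -> R) (t : R) :
  (forall i, derivable (F i) t 1) ->
  'D_1 (fun u => \sum_(i <- r) F i u) t = \sum_(i <- r) 'D_1 (F i) t.
Proof.
move=> dF; elim: r => [|i r IH].
  have -> : (fun u => \sum_(i <- [::]) F i u) = cst 0.
    by apply/funext => u; rewrite big_nil.
  by rewrite derive_cst big_nil.
have -> : (fun u => \sum_(j <- i :: r) F j u) = F i \+ (fun u => \sum_(j <- r) F j u).
  by apply/funext => u; rewrite big_cons.
rewrite deriveD ?IH ?big_cons //; exact: derivable_sum_fun.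
Qed.

Lemma derive_mxM m n k (A : R -> 'M[R]_(m, n)) (B : R -> 'M[R]_(n, k)) t :
  derivable_mx A t -> derivable_mx B t ->
  derive_mx (fun u => A u *m B u) t = derive_mx A t *m B t + A t *m derive_mx B t.
Proof.
move=> dA dB; apply/matrixP => a b; rewrite !mxE -big_split /=.
have -> : (fun u => (A u *m B u) a b) = (fun u => \sum_j A u a j * B u j b).
  by apply/funext => u; rewrite mxE.
rewrite derive_sum_fun; last by move=> j; exact: derivableM.
apply: eq_bigr => j _; rewrite !mxE deriveM // /GRing.scale /=.
by rewrite addrC [B t j b * _]mulrC.
Qed.

(** Differentiate [A^-1 A = 1]. *)
Lemma derive_invmx n (A : R -> 'M[R]_n) t :
  (forall u, A u \in unitmx) -> derivable_mx A t ->
  derive_mx (fun u => invmx (A u)) t =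
    - (invmx (A t) *m derive_mx A t *m invmx (A t)).
Proof.
move=> uA dA; have dV := derivable_invmx uA dA.
have : derive_mx (fun u => invmx (A u) *m A u) t = 0.
  have -> : (fun u => invmx (A u) *m A u) = (fun=> 1%:M).
    by apply/funext => u; rewrite mulVmx.
  by apply/matrixP => a b; rewrite !mxE; exact: derive_cst.
rewrite derive_mxM // => /(congr1 (fun M => M *m invmx (A t))).
rewrite mul0mx mulmxDl -[X in X + _]mulmxA mulmxV // mulmx1 => /eqP.
by rewrite addr_eq0 => /eqP.
Qed.

End MatrixCalculus.

(** * The Stein--Haff identity *)

Section SteinHaff.
Context {R : realType} (p q : nat).
Local Notation I := ('I_p * 'I_q)%type.

Definition family_mx (z : I -> R) : 'M[R]_(p, q) := \matrix_(i, j) z (i, j).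

(** The matrix unit has rank one, so the product is a column times a row. *)
Lemma mulmx_delta_entry m k l n (A : 'M[R]_(m, k)) (B : 'M[R]_(l, n)) i j a b :
  (A *m delta_mx i j *m B) a b = A a i * B j b.
Proof.
rewrite -(mul_delta_mx (0 : 'I_1)) mulmxA -colE -mulmxA -rowE mxE big_ord1.
by rewrite !mxE.
Qed.

Section Derivative.
Variables (eps : R) (e0 : 0 < eps) (z : I -> R) (i : 'I_p) (j : 'I_q).
Let G (t : R) := family_mx (update (i, j) z t).

Lemma derivable_update_mx t : derivable_mx G t.
Proof.
move=> a b; rewrite /G.
have -> : (fun u => family_mx (update (i, j) z u) a b) =
    if (a, b) == (i, j) then id else cst (z (a, b)).
  by apply/funext => u; rewrite mxE /update; case: ifP => /=; case: eqP.
case: ifP => _; [exact: derivable_id|exact: derivable_cst].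
Qed.

Lemma derive_update_mx t : derive_mx G t = delta_mx i j.
Proof.
apply/matrixP => a b; rewrite !mxE /G.
have -> : (fun u => family_mx (update (i, j) z u) a b) =
    if (a, b) == (i, j) then id else cst (z (a, b)).
  by apply/funext => u; rewrite mxE /update; case: ifP => /=; case: eqP.
rewrite xpair_eqE; case: ifP => _; [exact: derive_id|exact: derive_cst].
Qed.

Lemma derive_mxT m n (A : R -> 'M[R]_(m, n)) t :
  derive_mx (fun u => (A u)^T) t = (derive_mx A t)^T.
Proof.
apply/matrixP => a b; rewrite mxE [RHS]mxE mxE.
have -> // : (fun u => (A u)^T a b) = (fun u => A u b a).
by apply/funext => u; rewrite mxE.
Qed.

Lemma derive_mxDcst m n (A : R -> 'M[R]_(m, n)) (C : 'M[R]_(m, n)) t :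
  derivable_mx A t -> derive_mx (fun u => A u + C) t = derive_mx A t.
Proof.
move=> dA; apply/matrixP => a b; rewrite !mxE.
have -> : (fun u => (A u + C) a b) = (fun u => A u a b) \+ cst (C a b).
  by apply/funext => u; rewrite mxE.
by rewrite deriveD // derive_cst addr0.
Qed.

Lemma derivable_rgram t : derivable_mx (fun u => rgram eps (G u)) t.
Proof.
have dG : derivable_mx G t by exact: derivable_update_mx.
apply: derivable_mxD.
  by apply: derivable_mxM => //; exact: derivable_mxT.
move=> a b; exact: (@derivable_cst _ _ _ ((eps%:M : 'M[R]_p) a b)).
Qed.

Lemma derivable_rinv t : derivable_mx (fun u => rinv eps (G u)) t.
Proof.
apply: derivable_invmx; last exact: derivable_rgram.
by move=> u; exact: rgram_unit.
Qed.

Lemma derivable_rsolve t : derivable_mx (fun u => rsolve eps (G u)) t.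
Proof.
apply: derivable_mxM; first exact: derivable_rinv.
exact: derivable_update_mx.
Qed.

Lemma is_derive_rsolve t :
  is_derive t (1 : R) (fun u => rsolve eps (G u) i j) (rsolve_deriv eps (G t) i j).
Proof.
have dG : derivable_mx G t by exact: derivable_update_mx.
  have dV : derivable_mx (fun u => rinv eps (G u)) t by exact: derivable_rinv.
split; first exact: derivable_rsolve.
have -> : 'D_1 (fun u => rsolve eps (G u) i j) t =
    derive_mx (fun u => rinv eps (G u) *m G u) t i j by rewrite [RHS]mxE.
rewrite derive_mxM //.
rewrite [derive_mx (fun u => rinv eps (G u)) t]derive_invmx; last 2 first.
- by move=> u; exact: rgram_unit.
- exact: derivable_rgram.
have -> : derive_mx (fun u => rgram eps (G u)) t =
    delta_mx i j *m (G t)^T + G t *m delta_mx j i.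
  rewrite derive_mxDcst; last by apply: derivable_mxM => //; exact: derivable_mxT.
  rewrite derive_mxM //; last exact: derivable_mxT.
  by rewrite derive_mxT derive_update_mx trmx_delta.
rewrite -/(rinv eps (G t)) derive_update_mx mxE.
set Y := rinv eps (G t).
have -> : (Y *m delta_mx i j) i j = Y i i.
  by rewrite -[Y *m _]mulmx1 mulmx_delta_entry mxE eqxx mulr1.
rewrite mulNmx mxE mulmxDr !mulmxDl mxE.
have -> : (Y *m (delta_mx i j *m (G t)^T) *m Y *m G t) i j =
    Y i i * rhat eps (G t) j j.
  by rewrite mulmxA -!mulmxA mulmxA mulmx_delta_entry.
have -> : (Y *m (G t *m delta_mx j i) *m Y *m G t) i j = rsolve eps (G t) i j ^+ 2.
  by rewrite mulmxA -mulmxA mulmx_delta_entry expr2.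
by rewrite /rsolve_deriv; ring.
Qed.

Lemma continuous_rsolve_deriv :
  continuous (fun t => rsolve_deriv eps (G t) i j).
Proof.
move=> t; apply/differentiable_continuous/derivable1_diffP.
have dY : derivable_mx (fun u => rinv eps (G u)) t by exact: derivable_rinv.
have dB : derivable_mx (fun u => rsolve eps (G u)) t by exact: derivable_rsolve.
have dH : derivable_mx (fun u => rhat eps (G u)) t.
  by apply: derivable_mxM => //; apply: derivable_mxT; exact: derivable_update_mx.
have -> : (fun t => rsolve_deriv eps (G t) i j) =
    ((fun u => rinv eps (G u) i i) \-
     (fun u => rinv eps (G u) i i) \* (fun u => rhat eps (G u) j j)) \-
    (fun u => rsolve eps (G u) i j) \* (fun u => rsolve eps (G u) i j).
  by apply/funext => u; rewrite /rsolve_deriv expr2.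
have d1 := derivableM (dY i i) (dH j j).
have d2 := derivableM (dB i j) (dB i j).
exact: (derivableB (derivableB (dY i i) d1) d2).
Qed.

End Derivative.
Variables (d : measure_display) (T : measurableType d) (P : probability T R)
  (Z : T -> I -> R).
Hypothesis hZ : indep_normal (fun=> 1) P Z.
Local Notation G w := (family_mx (Z w)).

Lemma measurable_family_mx : measurable_mx (family_mx : family R I -> _).
Proof.
move=> i j.
have -> : (fun z : family R I => family_mx z i j) = (fun z => z (i, j)).
  by apply/funext => z; rewrite mxE.
exact: measurable_coord.
Qed.

Lemma measurable_gaussian_mx : measurable_mx (fun w => G w).
Proof. by move=> i j; under eq_fun do rewrite mxE; exact: hZ.1. Qed.

Lemma measurable_rinv d' (T' : measurableType d') (M : T' -> 'M[R]_(p, q)) eps :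
  measurable_mx M -> measurable_mx (fun w => rinv eps (M w)).
Proof.
move=> mM; apply: measurable_invmx; apply: measurable_mxD.
  by apply: measurable_mxM => //; exact: measurable_mxT.
exact: measurable_mx_cst.
Qed.

Lemma measurable_rsolve d' (T' : measurableType d') (M : T' -> 'M[R]_(p, q)) eps :
  measurable_mx M -> measurable_mx (fun w => rsolve eps (M w)).
Proof. by move=> mM; apply: measurable_mxM => //; exact: measurable_rinv. Qed.

Lemma measurable_rsolve_deriv d' (T' : measurableType d') (M : T' -> 'M[R]_(p, q))
    eps i j :
  measurable_mx M -> measurable_fun setT (fun w => rsolve_deriv eps (M w) i j).
Proof.
move=> mM; have mY := measurable_rinv eps mM; have mB := measurable_rsolve eps mM.
have mH : measurable_mx (fun w => rhat eps (M w)).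
  by apply: measurable_mxM => //; exact: measurable_mxT.
apply: measurable_funB; last by apply: measurable_funX; exact: mB.
apply: measurable_funB; first exact: mY.
by apply: measurable_funM; [exact: mY|exact: mH].
Qed.

(** The divergence of [rsolve_divergence] without its constant term. *)
Definition haff_form eps (M : 'M[R]_(p, q)) : R :=
  (q%:R - p%:R - 1) * \tr (rinv eps M) + eps * (\tr (rinv eps M)) ^+ 2
    + eps * \tr (rinv eps M *m rinv eps M) + eps * \tr (rinv eps M).

(** Integration by parts applied to every entry of [S^-1 G] and summed. *)
Lemma stein_haff eps : 0 < eps ->
  P.-integrable setT (fun w => (haff_form eps (G w))%:E) /\
  (\int[P]_w (haff_form eps (G w))%:E = p%:R%:E)%E.
Proof.
move=> e0.
pose f (ij : I) w : \bar R := (1 ^+ 2 * rsolve_deriv eps (G w) ij.1 ij.2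
  - Z w ij * rsolve eps (G w) ij.1 ij.2)%:E.
have hf ij : P.-integrable setT (f ij) /\ (\int[P]_w f ij w = 0)%E.
  apply: (stein_coord (s := fun=> 1) (fun _ => oner_neq0 R) hZ
    (h := fun z => rsolve eps (family_mx z) ij.1 ij.2)
    (h' := fun z => rsolve_deriv eps (family_mx z) ij.1 ij.2)
    (C := 1 + 3 * eps^-1)).
  - exact: (measurable_rsolve eps measurable_family_mx).
  - exact: (measurable_rsolve_deriv eps _ _ measurable_family_mx).
  - by move=> z t; rewrite (surjective_pairing ij); exact: is_derive_rsolve.
  - by move=> z; rewrite (surjective_pairing ij); exact: continuous_rsolve_deriv.
  - by move=> z; exact: rsolve_norm_le.
  - by move=> z; exact: rsolve_deriv_le.
have sumE w : (\sum_ij f ij w)%E = (haff_form eps (G w) - p%:R)%:E.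
  rewrite /f sumEFin -(rsolve_divergence (G w) e0) pair_big /=; congr EFin.
  apply: eq_bigr => ij _; rewrite expr1n mul1r; congr (_ - _ * _).
  by rewrite mxE -surjective_pairing.
have int0 : P.-integrable setT (fun w => (\sum_ij f ij w)%E).
  by apply: integrable_sum => // ij _; case: (hf ij).
have tot : (\int[P]_w (\sum_ij f ij w) = 0)%E.
  rewrite integral_sum //; last by move=> ij; case: (hf ij).
  by apply: big1 => ij _; case: (hf ij).
have ip : P.-integrable setT (fun=> p%:R%:E) by exact: finite_measure_integrable_cst.
have eE : (fun w => (haff_form eps (G w))%:E) = (fun w => (\sum_ij f ij w) + p%:R%:E)%E.
  by apply/funext => w; rewrite sumE -EFinD subrK.
rewrite eE; split; first exact: integrableD.
by rewrite integralD // tot add0e integral_prob_cst.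
Qed.

End SteinHaff.

(** * Comparison of regularized and plain inverse Gram matrices *)

Section TraceInverseLimit.
Context {R : realType} (p q : nat).
Implicit Types (M : 'M[R]_(p, q)).

Section Fixed.
Variables (eps : R) (M : 'M[R]_(p, q)).
Hypothesis e0 : 0 < eps.
Local Notation Y := (rinv eps M).
Local Notation Y0 := (invmx (M *m M^T)).

Lemma mxtrace_mulT_ge0 m n (A : 'M[R]_(m, n)) : 0 <= \tr (A *m A^T).
Proof.
rewrite mxtrace_mulT; apply: sumr_ge0 => i _; apply: sumr_ge0 => j _.
exact: sqr_ge0.
Qed.

Lemma tr_rinv_ge0 : 0 <= \tr Y.
Proof. by apply: sumr_ge0 => i _; exact: rinv_diag_ge0. Qed.

Lemma tr_rinv2_ge0 : 0 <= \tr (Y *m Y).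
Proof. by rewrite -{2}rinv_sym; exact: mxtrace_mulT_ge0. Qed.

Lemma tr_rinv2_le : eps * \tr (Y *m Y) <= \tr Y.
Proof.
have := congr1 mxtrace (rinvE M e0).
rewrite mxtraceD mxtraceZ rinv_sym => ->; rewrite lerDr.
exact: mxtrace_mulT_ge0.
Qed.

Lemma tr_rinv_le : eps * \tr Y <= p%:R.
Proof.
have h : 0 <= \tr (rhat eps M).
  by apply: sumr_ge0 => i _; case/andP: (rhat_diag01 M e0 i).
by rewrite -subr_ge0 -tr_rhat.
Qed.

Hypothesis uM : M *m M^T \in unitmx.

Lemma gram_inv_sym : Y0^T = Y0.
Proof. by rewrite trmx_inv trmx_mul trmxK. Qed.

Lemma gram_invE : Y0 = (Y0 *m M) *m (Y0 *m M)^T.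
Proof.
by rewrite trmx_mul gram_inv_sym !mulmxA -[Y0 *m M *m _]mulmxA mulVmx // mul1mx.
Qed.

Lemma resolvent : Y0 - Y = eps *: (Y *m Y0).
Proof.
have : Y *m (rgram eps M - M *m M^T) *m Y0 = Y0 - Y.
  rewrite mulmxBr mulmxBl mulVmx ?rgram_unit // mul1mx.
  by rewrite -mulmxA mulmxV // mulmx1.
by move=> <-; rewrite /rgram addrC addKr mul_mx_scalar -scalemxAl.
Qed.

Lemma resolvent_sym : Y0 - Y = eps *: (Y0 *m Y).
Proof.
have := congr1 trmx resolvent.
by rewrite linearB /= linearZ /= trmx_mul gram_inv_sym rinv_sym.
Qed.

(** By the resolvent identity, consecutive differences are [eps] times the trace of a
    positive semidefinite matrix. *)
Lemma tr_cross_bounds :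
  \tr (Y *m Y) <= \tr (Y *m Y0) <= \tr (Y0 *m Y0).
Proof.
have h1 : \tr (Y *m Y0) - \tr (Y *m Y) = eps * \tr (Y *m Y0 *m Y).
  rewrite -mxtraceZ -linearB /= -mulmxBr resolvent_sym -scalemxAr mulmxA //.
have h2 : \tr (Y0 *m Y0) - \tr (Y *m Y0) = eps * \tr (Y0 *m Y *m Y0).
  rewrite -mxtraceZ -linearB /= -mulmxBl resolvent_sym -scalemxAl //.
apply/andP; split; rewrite -subr_ge0 ?h1 ?h2 mulr_ge0 ?(ltW e0) //.
- have -> : Y *m Y0 *m Y = (Y *m (Y0 *m M)) *m (Y *m (Y0 *m M))^T.
    by rewrite (trmx_mul Y) rinv_sym {1}gram_invE !mulmxA.
  exact: mxtrace_mulT_ge0.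
- have -> : Y0 *m Y *m Y0 = (Y0 *m rsolve eps M) *m (Y0 *m rsolve eps M)^T +
      eps *: ((Y0 *m Y) *m (Y0 *m Y)^T).
    rewrite {1}(rinvE M e0) mulmxDr mulmxDl !trmx_mul gram_inv_sym !mulmxA.
    by rewrite -scalemxAr -scalemxAl !mulmxA.
  rewrite mxtraceD mxtraceZ addr_ge0 ?mulr_ge0 ?(ltW e0) //; exact: mxtrace_mulT_ge0.
Qed.

Lemma tr_rinv_cvg_bounds :
  0 <= \tr Y0 - \tr Y <= eps * \tr (Y0 *m Y0).
Proof.
rewrite -linearB /= resolvent mxtraceZ.
have /andP[h1 h2] := tr_cross_bounds; have h0 := tr_rinv2_ge0.
by rewrite mulr_ge0 ?(ltW e0) ?(le_trans h0) //= ler_wpM2l // ltW.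
Qed.

End Fixed.
End TraceInverseLimit.

(** * Gaussian matrices have full rank almost surely *)

Section AlmostSureRank.
Context {R : realType} (d : measure_display) (T : measurableType d)
  (P : probability T R).

Lemma ae_eq0_integral (f : T -> R) : measurable_fun setT f ->
  (forall w, 0 <= f w) -> (\int[P]_w (f w)%:E = 0)%E ->
  {ae P, forall w, f w = 0}.
Proof.
move=> mf f0 If.
have mf' : measurable_fun setT (EFin \o f) by apply/measurable_EFinP.
have : (\int[P]_w `|(EFin \o f) w| = 0)%E.
  by rewrite -[RHS]If; apply: eq_integral => w _ /=; rewrite ger0_norm.
move/(ae_eq_integral_abs P measurableT mf').1; apply: filterS => w h.
by have /= [] := h I.
Qed.

(** Expansion along the first row: only the first term depends on the first entry,
    and the minor and the other cofactors do not. *)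
Lemma det_update n (z : 'I_n.+1 * 'I_n.+1 -> R) :
  exists r, forall t, \det (family_mx (update (ord0, ord0) z t)) =
    t * \det (family_mx (fun ij => z (lift ord0 ij.1, lift ord0 ij.2))) + r.
Proof.
exists (\sum_(j < n) z (ord0, lift ord0 j) * cofactor (family_mx z) ord0 (lift ord0 j)).
move=> t; rewrite (expand_det_row _ ord0) big_ord_recl; congr (_ + _).
  rewrite !mxE /update eqxx /=; congr (_ * _).
  rewrite /cofactor expr0 mul1r; congr (\det _); apply/matrixP => i j.
  by rewrite !mxE /=.
apply: eq_bigr => j _; congr (_ * _); first by rewrite !mxE /update.
rewrite /cofactor; congr (_ * \det _); apply/matrixP => i k.
by rewrite !mxE /update /=.
Qed.

(** Normal laws are absolutely continuous. *)
Lemma normal_prob_set1 (s x : R) : normal_prob 0 s [set x] = 0%E.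
Proof.
have /null_content_dominatesP h := normal_prob_dominates 0 s.
by apply: h => //; exact: lebesgue_measure_set1.
Qed.

Definition zero_indicator (x : R) : R := if x == 0 then 1 else 0.

Lemma measurable_zero_indicator : measurable_fun setT zero_indicator.
Proof. by apply: measurable_fun_ifT => //; exact: measurable_fun_eqr. Qed.

Lemma zero_indicator_ge0 x : 0 <= zero_indicator x.
Proof. by rewrite /zero_indicator; case: ifP. Qed.

(** The determinant is an affine function of its first entry, with the minor as
    slope: off the null set where the minor vanishes, at most one value of the
    entry makes the matrix singular. *)
Lemma gaussian_det_neq0 n (Z : T -> 'I_n * 'I_n -> R) :
  indep_normal (fun=> 1) P Z -> {ae P, forall w, \det (family_mx (Z w)) != 0}.
Proof.
elim: n => [|n IH] in Z *.
  by move=> _; apply: aeW => w; rewrite det_mx00 oner_neq0.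
move=> hZ; pose g (ij : 'I_n * 'I_n) := (lift ord0 ij.1, lift ord0 ij.2) : 'I_n.+1 * 'I_n.+1.
have g_inj : injective g.
  move=> [a b] [c e] h; congr (_, _); apply: (@lift_inj _ ord0).
    exact: (congr1 fst h).
  exact: (congr1 snd h).
have hZ' := indep_normal_reindex g_inj hZ.
have aeM := IH _ hZ'.
pose f (z : family R ('I_n.+1 * 'I_n.+1)%type) : \bar R := (zero_indicator (\det (family_mx z)))%:E.
have mf : measurable_fun setT f.
  apply/measurable_EFinP; apply: (measurableT_comp measurable_zero_indicator).
  by apply: measurable_det; exact: measurable_family_mx.
have f0 z : (0 <= f z)%E by rewrite lee_fin zero_indicator_ge0.
have If : (\int[P]_w f (Z w) = 0)%E.
  rewrite (ge0_integral_mix (predC1 (ord0, ord0)) hZ hZ mf f0) /=.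
  have mm := measurable_mix (predC1 (ord0, ord0)) hZ.1 hZ.1 mf.
  rewrite -[RHS](integral0 P setT); apply: ae_eq_integral => //.
    apply: (measurable_fun_fubini_tonelli_F (fun w => f _) mm) => w; exact: f0.
  apply: filterS aeM => w1 m0 _ /=.
  have [r rE] := det_update (Z w1).
  pose pt := - r / \det (family_mx (fun ij => Z w1 (g ij))).
  have mzp : measurable_fun setT (fun t : R => zero_indicator (t - pt)).
    by apply: (measurableT_comp measurable_zero_indicator); exact: measurable_funB.
  transitivity (\int[P]_w2 (zero_indicator (Z w2 (ord0, ord0) - pt))%:E)%E.
    apply: eq_integral => w2 _; rewrite /f.
    have -> : (fun i => if i != (ord0, ord0) then Z w1 i else Z w2 i) =
        update (ord0, ord0) (Z w1) (Z w2 (ord0, ord0)).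
      by apply/funext => i; rewrite /update; case: eqP => // ->.
    rewrite rE /zero_indicator (_ : _ + r = (Z w2 (ord0, ord0) - pt) *
        \det (family_mx (fun ij => Z w1 (g ij)))).
      by rewrite mulf_eq0 (negbTE m0) orbF.
    by rewrite mulrBl /pt divfK // opprK.
  rewrite (ge0_integral_coord hZ (ord0, ord0) (g := fun t => (zero_indicator (t - pt))%:E)) //; last 2 first.
  - by apply/measurable_EFinP.
  - by move=> x; rewrite lee_fin zero_indicator_ge0.
  transitivity (\int[normal_prob 0 1]_x (\1_[set pt] x)%:E)%E.
    apply: eq_integral => x _; congr _%:E; rewrite /zero_indicator indicE subr_eq0.
    by case: eqP => [->|h]; [rewrite mem_set|rewrite memNset].
  by rewrite integral_indic // setIT; exact: normal_prob_set1.
have mk : measurable_fun setT (fun w => zero_indicator (\det (family_mx (Z w)))).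
  apply: (measurableT_comp measurable_zero_indicator); apply: measurable_det.
  exact: (measurable_gaussian_mx hZ).
apply: filterS (ae_eq0_integral mk (fun w => zero_indicator_ge0 _) If) => w.
by rewrite /zero_indicator; case: eqP => // _ /eqP; rewrite oner_eq0.
Qed.

(** A row vector that kills [M M^T] kills [M], hence every square block of columns. *)
Lemma gram_unit_of_minor (m n : nat) (hmn : (m <= n)%N) (M : 'M[R]_(m, n)) :
  \det (colsub (widen_ord hmn) M) != 0 -> M *m M^T \in unitmx.
Proof.
move=> dM; rewrite -row_free_unit; apply: inj_row_free => v vS.
have h : (v *m M *m (v *m M)^T) 0 0 = 0.
  by rewrite trmx_mul !mulmxA -[v *m M *m M^T]mulmxA vS mul0mx mxE.
have vM : v *m M = 0.
  rewrite mxdiag_mulT in h; apply/rowP => j; rewrite [RHS]mxE.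
  apply/eqP; rewrite -sqrf_eq0; apply/eqP.
  by apply: (psumr_eq0P _ h) => // k _; exact: sqr_ge0.
have uM : colsub (widen_ord hmn) M \in unitmx by rewrite unitmxE unitfE.
apply: (can_inj (mulmxK uM)); rewrite mul0mx.
apply/rowP => j; rewrite [RHS]mxE.
have -> : (v *m colsub (widen_ord hmn) M) 0 j = (v *m M) 0 (widen_ord hmn j).
  by rewrite !mxE; apply: eq_bigr => k _; rewrite mxE.
by rewrite vM mxE.
Qed.

Lemma gaussian_gram_unit (m n : nat) (hmn : (m <= n)%N) (Z : T -> 'I_m * 'I_n -> R) :
  indep_normal (fun=> 1) P Z ->
  {ae P, forall w, family_mx (Z w) *m (family_mx (Z w))^T \in unitmx}.
Proof.
move=> hZ; pose g (ij : 'I_m * 'I_m) : 'I_m * 'I_n := (ij.1, widen_ord hmn ij.2).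
have g_inj : injective g.
  move=> [a b] [c e] h; congr (_, _); first exact: (congr1 fst h).
  by apply: val_inj; exact: (congr1 (fun x : 'I_m * 'I_n => val x.2) h).
apply: filterS (gaussian_det_neq0 (indep_normal_reindex g_inj hZ)) => w dw.
apply: (@gram_unit_of_minor _ _ hmn).
rewrite (_ : colsub _ _ = family_mx (fun j => Z w (g j))) //.
by apply/matrixP => i j; rewrite !mxE.
Qed.

End AlmostSureRank.

(** * The expected trace of the inverse Gram matrix *)

Section ExpectedTraceInverse.
Context {R : realType} (p q : nat).

Section Fixed.
Variables (eps : R) (M : 'M[R]_(p, q)).
Hypotheses (e0 : 0 < eps) (e1 : eps <= 1) (uM : M *m M^T \in unitmx).
Local Notation Y0 := (invmx (M *m M^T)).
Local Notation a := (\tr (rinv eps M)).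
Local Notation b := (\tr (rinv eps M *m rinv eps M)).
Local Notation c := (\tr Y0).

Lemma tr_rinv_le_inv : a <= c.
Proof. by have /andP[h _] := tr_rinv_cvg_bounds e0 uM; rewrite -subr_ge0. Qed.

(** Every term is dominated by a multiple of [c] because [eps * a <= p],
    [eps * b <= a] and [a <= c]; this is the domination needed as [eps] tends to 0. *)
Lemma haff_norm_le : `|haff_form eps M| <= (q%:R + 2 * p%:R + 3) * c.
Proof.
have a0 := tr_rinv_ge0 M e0; have b0 := tr_rinv2_ge0 eps M.
have ac := tr_rinv_le_inv; have ba := tr_rinv2_le M e0.
have ap := tr_rinv_le M e0.
have h2 : 0 <= eps * a ^+ 2 <= p%:R * c.
  rewrite mulr_ge0 ?sqr_ge0 ?(ltW e0) //= expr2 mulrA.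
  by apply: ler_pM => //; rewrite mulr_ge0 // ltW.
have h3 : 0 <= eps * b by rewrite mulr_ge0 // ltW.
have h4 : 0 <= eps * a <= a.
  by rewrite mulr_ge0 ?(ltW e0) //= -[leRHS]mul1r ler_wpM2r.
have h1 : `|(q%:R - p%:R - 1) * a| <= (q%:R + p%:R + 1) * c.
  rewrite normrM (ger0_norm a0) ler_pM //.
  have := ler0n R q; have := ler0n R p => ? ?.
  by rewrite ler_norml; apply/andP; split; lra.
move: h2 h4 => /andP[h2 h2'] /andP[h4 h4'].
have h : `|haff_form eps M| <= `|(q%:R - p%:R - 1) * a| + (eps * a ^+ 2 + eps * b + eps * a).
  rewrite /haff_form -!addrA; apply: le_trans (ler_normD _ _) _; rewrite lerD2l.
  by rewrite ger0_norm // !addr_ge0.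
apply: le_trans h _.
have -> : (q%:R + 2 * p%:R + 3) * c = (q%:R + p%:R + 1) * c + (p%:R * c + c + c) by ring.
lra.
Qed.

(** The terms with a factor [eps] vanish and [a] tends to [c], at a rate that depends
    on [M] only. *)
Lemma haff_cvg_bound : `|haff_form eps M - (q%:R - p%:R - 1) * c| <=
  eps * ((q%:R + p%:R + 2) * \tr (Y0 *m Y0) + c ^+ 2 + c).
Proof.
have a0 := tr_rinv_ge0 M e0; have b0 := tr_rinv2_ge0 eps M.
have ac := tr_rinv_le_inv; have /andP[d0 d1] := tr_rinv_cvg_bounds e0 uM.
have /andP[bc cb] := tr_cross_bounds e0 uM; have bb := le_trans bc cb.
set b' := \tr (Y0 *m Y0) in bb d1 *.
have h1 : `|(q%:R - p%:R - 1) * (a - c)| <= (q%:R + p%:R + 1) * (eps * b').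
  rewrite normrM ler_pM //.
    have := ler0n R q; have := ler0n R p => ? ?.
    by rewrite ler_norml; apply/andP; split; lra.
  by rewrite distrC ger0_norm.
have h2 : eps * a ^+ 2 <= eps * c ^+ 2.
  by rewrite ler_pM2l // ler_pXn2r // nnegrE (le_trans a0).
have h3 : eps * b <= eps * b' by rewrite ler_pM2l.
have h4 : eps * a <= eps * c by rewrite ler_pM2l.
have e2 : haff_form eps M - (q%:R - p%:R - 1) * c = (q%:R - p%:R - 1) * (a - c)
   + (eps * a ^+ 2 + eps * b + eps * a) by rewrite /haff_form; ring.
have pos : 0 <= eps * a ^+ 2 + eps * b + eps * a.
  by rewrite !addr_ge0 // mulr_ge0 ?sqr_ge0 // ltW.
rewrite e2; apply: le_trans (ler_normD _ _) _; rewrite (ger0_norm pos).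
have -> : eps * ((q%:R + p%:R + 2) * b' + c ^+ 2 + c) =
  (q%:R + p%:R + 1) * (eps * b') + (eps * c ^+ 2 + eps * b' + eps * c) by ring.
lra.
Qed.

End Fixed.

Lemma tr_invmx_gram_ge0 (M : 'M[R]_(p, q)) : 0 <= \tr (invmx (M *m M^T)).
Proof.
have [uM|uM] := boolP (M *m M^T \in unitmx).
  by rewrite gram_invE //; exact: mxtrace_mulT_ge0.
by rewrite invmx_out //; exact: mxtrace_mulT_ge0.
Qed.

Lemma cvg_harmonic_bound (u : nat -> R) (l L : R) :
  (forall n, `|u n - l| <= n.+1%:R^-1 * L) -> u @ \oo --> l.
Proof.
move=> h; apply/subr_cvg0; apply: norm_cvg0.
apply: (@squeeze_cvgr _ _ _ _ (fun=> 0) (fun n => harmonic n * L)).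
- by apply: nearW => n; rewrite normr_ge0 /=; exact: h.
- exact: cvg_cst.
- by rewrite -[X in _ --> X](mul0r L); apply: cvgM; [exact: cvg_harmonic|exact: cvg_cst].
Qed.

Context (d : measure_display) (T : measurableType d) (P : probability T R)
  (Z : T -> 'I_p * 'I_q -> R).
Hypothesis hZ : indep_normal (fun=> 1) P Z.
Hypothesis hpq : (p <= q)%N.
Local Notation G w := (family_mx (Z w)).
Let c w := \tr (invmx (G w *m (G w)^T)).
Let eps n : R := n.+1%:R^-1.

Let eps0 n : 0 < eps n. Proof. by rewrite invr_gt0 ltr0n. Qed.
Let eps1 n : eps n <= 1. Proof. by rewrite invf_le1 ?ltr0n // ler1n. Qed.

Lemma measurable_tr_invmx_gram d' (T' : measurableType d') m n (M : T' -> 'M[R]_(m, n)) :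
  measurable_mx M ->
  measurable_fun setT (fun w => \tr (invmx (M w *m (M w)^T))).
Proof.
move=> mM; apply: measurable_tr; apply: measurable_invmx.
by apply: measurable_mxM => //; exact: measurable_mxT.
Qed.

Let mc : measurable_fun setT c.
Proof. exact: (measurable_tr_invmx_gram (measurable_gaussian_mx hZ)). Qed.

Let mEc : measurable_fun setT (EFin \o c).
Proof. by apply/measurable_EFinP. Qed.

(** The limit of [stein_haff] as the regularization vanishes. *)
Lemma trace_inverse_equation : P.-integrable setT (EFin \o c) ->
  ((q%:R - p%:R - 1)%:E * \int[P]_w (c w)%:E = p%:R%:E)%E.
Proof.
move=> ic.
pose f_ n w : \bar R := (haff_form (eps n) (G w))%:E.
pose f w : \bar R := ((q%:R - p%:R - 1)%:E * (c w)%:E)%E.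
pose g w : \bar R := ((q%:R + 2 * p%:R + 3)%:E * (c w)%:E)%E.
have mf_ n : measurable_fun setT (f_ n).
  by have [i _] := stein_haff hZ (eps0 n); exact: measurable_int i.
have mf : measurable_fun setT f by exact: emeasurable_funM.
have h2 : {ae P, forall w, setT w -> f_ n w @[n --> \oo] --> f w}.
  apply: filterS (gaussian_gram_unit hpq hZ) => w uw _.
  apply: cvg_EFin; first exact: nearW.
  apply: cvg_harmonic_bound => n; exact: haff_cvg_bound.
have ig : P.-integrable setT g by exact: integrableZl.
have h3 : {ae P, forall w n, setT w -> (`|f_ n w| <= g w)%E}.
  apply: filterS (gaussian_gram_unit hpq hZ) => w uw n _.
  by rewrite /f_ /g -EFinM lee_fin; exact: haff_norm_le.
have [_ _ cv] := dominated_convergence measurableT mf_ mf h2 ig h3.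
have <- : (\int[P]_w f w = (q%:R - p%:R - 1)%:E * \int[P]_w (c w)%:E)%E.
  exact: integralZl.
apply: (cvg_unique _ cv) => //.
have -> : [sequence \int[P]_w f_ n w]_n%E = fun=> p%:R%:E.
  by apply/funext => n; have [_] := stein_haff hZ (eps0 n).
exact: cvg_cst.
Qed.

(** Fatou's lemma bounds the expectation as soon as the coefficient of
    the trace in the Stein--Haff identity is positive. *)
Lemma trace_inverse_integrable : (p + 2 <= q)%N ->
  P.-integrable setT (EFin \o c).
Proof.
move=> pq2.
pose f_ n w : \bar R := (\tr (rinv (eps n) (G w)))%:E.
have mf_ n : measurable_fun setT (f_ n).
  apply/measurable_EFinP; apply: measurable_tr; apply: measurable_rinv.
  exact: (measurable_gaussian_mx hZ).
have f0 n w : setT w -> (0 <= f_ n w)%E.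
  by move=> _; rewrite lee_fin; exact: tr_rinv_ge0.
have k0 : 0 < q%:R - p%:R - 1 :> R.
  by have : (p + 2)%:R <= q%:R :> R; [rewrite ler_nat|rewrite natrD; lra].
have bnd n : (\int[P]_w f_ n w <= (p%:R / (q%:R - p%:R - 1))%:E)%E.
  have [ih Eh] := stein_haff hZ (eps0 n).
  rewrite mulrC EFinM lee_pdivlMl //.
  rewrite -ge0_integralZl //; [|exact: f0|by rewrite lee_fin ltW].
  rewrite -Eh; apply: ge0_le_integral => //.
  - by move=> w _; rewrite mule_ge0 // ?lee_fin ?(ltW k0) //; exact: tr_rinv_ge0.
  - by apply: emeasurable_funM.
  - exact: measurable_int ih.
  - move=> w _; rewrite -EFinM lee_fin /haff_form -!addrA lerDl.
    have ? := tr_rinv_ge0 (G w) (eps0 n); have ? := tr_rinv2_ge0 (eps n) (G w).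
    by rewrite !addr_ge0 // mulr_ge0 ?sqr_ge0 // ltW.
have fat := fatou P measurableT mf_ f0.
apply/integrableP; split => //.
have -> : (\int[P]_w `|(EFin \o c) w| = \int[P]_w limn_einf (f_^~ w))%E.
  apply: ae_eq_integral => //.
  - exact: measurableT_comp.
  - apply: (emeasurable_fun_cvg (fun n w => einfs (f_^~ w) n)) => //.
      exact: measurable_fun_einfs.
    by move=> w _; rewrite limn_einf_lim; exact: is_cvg_einfs.
  - apply: filterS (gaussian_gram_unit hpq hZ) => w uw _.
    have cv : f_ n w @[n --> \oo] --> (c w)%:E.
      apply: cvg_EFin; first exact: nearW.
      apply: (@cvg_harmonic_bound _ _ (\tr (invmx (G w *m (G w)^T) *m invmx (G w *m (G w)^T)))) => n.
      have /andP[? ?] := tr_rinv_cvg_bounds (eps0 n) uw.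
      by rewrite distrC ger0_norm.
    rewrite is_cvg_limn_einfE; last by apply/cvg_ex; eexists; exact: cv.
    by rewrite (cvg_lim _ cv) //= ger0_norm //; exact: tr_invmx_gram_ge0.
apply: le_lt_trans fat _; apply: (@le_lt_trans _ _ (p%:R / (q%:R - p%:R - 1))%:E); last exact: ltry.
rewrite limn_einf_lim; apply: lime_le; first exact: is_cvg_einfs.
apply: nearW => n; apply: le_trans (bnd n).
by apply: ereal_inf_lbound; exists n => /=.
Qed.

(** If the expectation were finite for [q <= p + 1], [trace_inverse_equation] would
    equate the positive number [p] with a nonpositive one. *)
Theorem expected_trace_inverse : (0 < p)%N ->
  (\int[P]_w (\tr (invmx (G w *m (G w)^T)))%:E =
   if (p + 2 <= q)%N then (p%:R / (q%:R - p%:R - 1))%:E else +oo)%E.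
Proof.
move=> p0; case: ifPn => hq.
  have ic := trace_inverse_integrable hq.
  have := trace_inverse_equation ic.
  have k0 : q%:R - p%:R - 1 != 0 :> R.
    rewrite gt_eqF //.
    by have : (p + 2)%:R <= q%:R :> R; [rewrite ler_nat|rewrite natrD; lra].
  have := integrable_fin_num measurableT ic.
  rewrite [X in X \is a _]/= -/(c _); case: (\int[P]_w _)%E => // r _.
  by rewrite -EFinM => -[h]; congr _%:E; apply: (mulfI k0); rewrite h mulrCA divff ?mulr1.
apply/eqP; rewrite -leye_eq leNgt; apply/negP => lty.
have ic : P.-integrable setT (EFin \o c).
  apply/integrableP; split => //; apply: le_lt_trans lty.
  rewrite le_eqVlt; apply/orP; left; apply/eqP; apply: eq_integral => w _ /=.
  by rewrite ger0_norm //; exact: tr_invmx_gram_ge0.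
have h := trace_inverse_equation ic.
have : ((q%:R - p%:R - 1)%:E * \int[P]_w (c w)%:E <= 0)%E.
  apply: mule_le0_ge0; last by apply: integral_ge0 => w _; rewrite lee_fin tr_invmx_gram_ge0.
  rewrite lee_fin; rewrite -ltnNge in hq.
  have : q%:R <= (p + 1)%:R :> R by rewrite ler_nat; rewrite addn2 addn1 in hq *.
  by rewrite natrD; lra.
by rewrite h lee_fin leNgt ltr0n p0.
Qed.

End ExpectedTraceInverse.

(** * The part of a vector lost by projecting on a Gaussian row space *)

Section ProjectionBias.
Context {R : realType} (p q : nat).
Implicit Types (M : 'M[R]_(p, q)) (U : 'M[R]_q).

(** For [M] of full row rank this is minus the orthogonal projection on the kernel
    of [M]. *)
Definition proj_defect M : 'M[R]_q := M^T *m invmx (M *m M^T) *m M - 1%:M.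

Lemma enorm_sqr_tr k (v : 'cV[R]_k) : enorm v ^+ 2 = \tr (v *m v^T).
Proof.
rewrite enorm_sqrE mxtrace_mulT; apply: eq_bigr => i _.
by rewrite big_ord1.
Qed.

Lemma orthogonal_enorm U (v : 'cV[R]_q) : U *m U^T = 1%:M ->
  enorm (U^T *m v) ^+ 2 = enorm v ^+ 2.
Proof.
by move=> UU; rewrite !enorm_sqr_tr trmx_mul trmxK mxtrace_mulC -mulmxA [U *m _]mulmxA UU mul1mx mxtrace_mulC.
Qed.

(** Since [(M U) (M U)^T = M M^T], only the outer factors see [U]. *)
Lemma proj_defect_orthogonal M U : U *m U^T = 1%:M ->
  proj_defect (M *m U) = U^T *m proj_defect M *m U.
Proof.
move=> UU; rewrite /proj_defect mulmxBr mulmxBl mulmx1 (mulmx1C UU); congr (_ - _).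
by rewrite !trmx_mul !mulmxA -[M *m U *m U^T]mulmxA UU mulmx1.
Qed.

(** Minus the defect is a symmetric idempotent, so its squared Frobenius norm is its
    trace. *)
Lemma tr_proj_defect M : M *m M^T \in unitmx ->
  \tr (proj_defect M *m (proj_defect M)^T) = q%:R - p%:R.
Proof.
move=> uM; set Y := invmx (M *m M^T); set H := M^T *m Y *m M.
have Hs : H^T = H by rewrite /H !trmx_mul trmxK /Y gram_inv_sym // mulmxA.
have HH : H *m H = H.
  rewrite /H !mulmxA -[M^T *m Y *m M *m M^T]mulmxA -[M^T *m Y *m (M *m M^T)]mulmxA.
  by rewrite /Y mulVmx // mulmx1.
have trH : \tr H = p%:R.
  by rewrite /H -mulmxA mxtrace_mulC -mulmxA /Y mulVmx // mxtrace1.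
rewrite /proj_defect -/Y -/H linearB /= Hs trmx1 mulmxBl mulmxBr HH mulmx1 subrr.
by rewrite sub0r mulmxBr mul1mx mulmx1 opprB linearB /= mxtrace1 trH.
Qed.

Definition reflect_mx (j : 'I_q) : 'M[R]_q :=
  diag_mx (\row_k (-1) ^+ (k == j)).

Lemma reflect_mx_orth j : reflect_mx j *m (reflect_mx j)^T = 1%:M.
Proof.
rewrite /reflect_mx tr_diag_mx mulmx_diag; apply/matrixP => a b.
by rewrite !mxE; case: (a == j); rewrite ?expr0 ?expr1 ?mulrNN mulr1.
Qed.

Lemma reflect_mx_col j (v : 'I_q -> R) :
  reflect_mx j *m (\col_i v i) = \col_i flip j v i.
Proof.
apply/matrixP => a b; rewrite /reflect_mx mul_diag_mx !mxE /flip.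
by case: eqP => _; rewrite ?expr0 ?expr1 ?mul1r ?mulN1r.
Qed.

Lemma tperm_mx_orth (j k : 'I_q) : tperm_mx j k *m (tperm_mx j k)^T = 1%:M :> 'M[R]_q.
Proof. by rewrite /tperm_mx tr_perm_mx -perm_mxM tpermV tperm2 perm_mx1. Qed.

Lemma proj_quadratic (A : 'M[R]_q) (u : 'I_q -> R) (i : 'I_q) :
  enorm (A *m \col_k u k) ^+ 2 + enorm (A *m \col_k flip i u k) ^+ 2 =
  2 * (enorm (A *m \col_k erase i u k) ^+ 2 + u i ^+ 2 * enorm (A *m delta_mx i 0) ^+ 2).
Proof.
have e1 : (\col_k u k : 'cV[R]_q) = \col_k erase i u k + u i *: delta_mx i 0.
  apply/matrixP => a b; rewrite !mxE /erase ord1 andbT.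
  by case: eqP => [->|_]; rewrite ?mulr1 ?add0r ?mulr0 ?addr0.
have e2 : (\col_k flip i u k : 'cV[R]_q) = \col_k erase i u k - u i *: delta_mx i 0.
  apply/matrixP => a b; rewrite !mxE /flip /erase ord1 andbT.
  by case: eqP => [->|_]; rewrite ?mulr1 ?sub0r ?mulr0 ?subr0.
rewrite e1 e2 mulmxDr mulmxBr -scalemxAr !enorm_sqrE.
rewrite -big_split /= [X in _ = 2 * (_ + X)]mulr_sumr -big_split /= mulr_sumr.
by apply: eq_bigr => a _; rewrite !mxE; ring.
Qed.

Context (d : measure_display) (T : measurableType d) (P : probability T R)
  (Z : T -> 'I_p * 'I_q -> R).
Hypothesis hZ : indep_normal (fun=> 1) P Z.
Hypothesis hpq : (p <= q)%N.
Local Notation G w := (family_mx (Z w)).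

Lemma measurable_proj_defect d' (T' : measurableType d') (M : T' -> 'M[R]_(p, q)) :
  measurable_mx M -> measurable_mx (fun w => proj_defect (M w)).
Proof.
move=> mM; apply: measurable_mxB; last exact: measurable_mx_cst.
apply: measurable_mxM => //; apply: measurable_mxM; first exact: measurable_mxT.
by apply: measurable_invmx; apply: measurable_mxM => //; exact: measurable_mxT.
Qed.

Lemma measurable_defect_sqr d' (T' : measurableType d') (M : T' -> 'M[R]_(p, q))
    (v : 'cV[R]_q) : measurable_mx M ->
  measurable_fun setT (fun w => enorm (proj_defect (M w) *m v) ^+ 2).
Proof.
move=> mM; apply: measurable_enorm_sqr; apply: measurable_mxM.
  exact: measurable_proj_defect.
exact: measurable_mx_cst.
Qed.

(** Moving an orthogonal matrix from the design to the vector. *)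
Lemma integral_defect_orthogonal (Z' : T -> 'I_p * 'I_q -> R) U (v v' : 'cV[R]_q) :
  indep_normal (fun=> 1) P Z' -> (forall w, family_mx (Z' w) = G w *m U) ->
  U *m U^T = 1%:M -> U *m v = v' ->
  (\int[P]_w (enorm (proj_defect (G w) *m v') ^+ 2)%:E =
   \int[P]_w (enorm (proj_defect (G w) *m v) ^+ 2)%:E)%E.
Proof.
move=> hZ' eZ UU <-.
pose f (z : family R ('I_p * 'I_q)%type) : \bar R :=
  (enorm (proj_defect (family_mx z) *m v) ^+ 2)%:E.
have mf : measurable_fun setT f.
  by apply/measurable_EFinP; apply: measurable_defect_sqr; exact: measurable_family_mx.
have f0 z : (0 <= f z)%E by rewrite lee_fin sqr_ge0.
rewrite -[RHS](ge0_integral_same_law hZ' hZ mf f0); apply: eq_integral => w _.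
rewrite /f eZ proj_defect_orthogonal // -!mulmxA orthogonal_enorm //.
Qed.

(** A Gaussian design with at most as many rows as columns projects on a random
    subspace whose law is invariant under sign changes and permutations of the
    columns, so every direction loses the same share of its squared length. *)
Theorem expected_proj_defect (v : 'cV[R]_q) : (0 < q)%N ->
  (\int[P]_w (enorm (proj_defect (G w) *m v) ^+ 2)%:E =
   (enorm v ^+ 2 * (1 - p%:R / q%:R))%:E)%E.
Proof.
move=> q0; have mG := measurable_gaussian_mx hZ.
pose e j w := enorm (proj_defect (G w) *m delta_mx j 0) ^+ 2.
have me j : measurable_fun setT (e j) by exact: measurable_defect_sqr.
have e_ge0 j w : 0 <= e j w by exact: sqr_ge0.
(* Swapping two columns of the design preserves its law. *)
have e_eq j k : (\int[P]_w (e j w)%:E = \int[P]_w (e k w)%:E)%E.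
  pose g (ab : 'I_p * 'I_q) := (ab.1, tperm j k ab.2).
  have g_inj : injective g.
    by move=> [a b] [a' b'] [-> /perm_inj ->].
  apply: (integral_defect_orthogonal (indep_normal_reindex g_inj hZ)
    (U := tperm_mx j k)); last 2 first.
  - exact: tperm_mx_orth.
  - rewrite -xrowE; apply/matrixP => a b; rewrite !mxE.
    congr ((_ && _)%:R).
    by rewrite -[X in _ == X](tpermL j k) (inj_eq perm_inj).
  - by move=> w; rewrite -xcolE; apply/matrixP => a b; rewrite !mxE.
have sum_e : (\sum_j \int[P]_w (e j w)%:E = (q%:R - p%:R)%:E)%E.
  rewrite -ge0_integral_sum //; last 2 first.
  - by move=> j; apply/measurable_EFinP.
  - by move=> j w _; rewrite lee_fin.
  rewrite -[RHS](integral_prob_cst P); apply: ae_eq_integral => //.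
  - by apply: emeasurable_sum => j; apply/measurable_EFinP.
  - apply: filterS (gaussian_gram_unit hpq hZ) => w uw _.
    rewrite sumEFin -(tr_proj_defect uw) mxtrace_mulT exchange_big /=; congr _%:E.
    apply: eq_bigr => j _; rewrite /e enorm_sqrE; apply: eq_bigr => i _.
    by rewrite -colE mxE.
have e_val j : (\int[P]_w (e j w)%:E = (1 - p%:R / q%:R)%:E)%E.
  move: sum_e; under eq_bigr do rewrite -(e_eq j).
  have : (0 <= \int[P]_w (e j w)%:E)%E by apply: integral_ge0 => w _; rewrite lee_fin.
  have q0' : q%:R != 0 :> R by rewrite pnatr_eq0 -lt0n.
  case: (\int[P]_w _)%E => [r _|_|//].
    rewrite sumEFin sumr_const card_ord => -[h]; congr _%:E.
    have h' : q%:R * r = q%:R - p%:R by rewrite mulr_natl; exact: h.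
    by apply: (mulfI q0'); rewrite h' mulrBr mulr1 mulrCA divff ?mulr1.
  by rewrite (bigD1 j) //= addye // -ltNye (@lt_le_trans _ _ 0%E) ?ltNyr // sume_ge0.
rewrite (_ : (fun w => _) = (fun w => (enorm (proj_defect (G w) *m \col_k v k 0) ^+ 2)%:E)).
  rewrite (@integral_even_quadratic _ _ _ P _
    (fun w u => enorm (proj_defect (G w) *m \col_k u k) ^+ 2) e (fun k => v k 0)).
  - rewrite [X in (X + _)%E](_ : _ = 0%E).
      under eq_bigr do rewrite e_val -EFinM.
      by rewrite add0e sumEFin -mulr_suml enorm_sqrE.
    rewrite -[RHS](integral_prob_cst P); apply: eq_integral => w _.
    have -> : (\col_k (0 : R) : 'cV[R]_q) = 0 by apply/matrixP => a b; rewrite !mxE.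
    by rewrite mulmx0 enorm_sqrE big1 // => i _; rewrite mxE expr0n.
  - by move=> w u; exact: sqr_ge0.
  - exact: e_ge0.
  - by move=> u; exact: measurable_defect_sqr.
  - exact: me.
  - by move=> w u i; exact: proj_quadratic.
  - move=> u i.
    apply: (integral_defect_orthogonal (U := reflect_mx i)
      (indep_normal_sign (fun ab => ab.2 == i) (fun=> oner_neq0 R) hZ)).
    + move=> w; apply/matrixP => a b.
      by rewrite mul_mx_diag !mxE mulrC.
    + exact: reflect_mx_orth.
    + exact: reflect_mx_col.
apply/funext => w; congr (enorm (_ *m _) ^+ 2)%:E.
by apply/matrixP => a b; rewrite mxE ord1.
Qed.

End ProjectionBias.

(** * The data model as one normal family *)

Section DataModelFamily.
Context {R : realType} (dsp : measure_display) (T : measurableType dsp)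
  (P : probability T R).

Lemma sigma_fin_bigcap (S : set (set T)) (I : finType) (F : I -> set T) :
  (forall i, <<s S >> (F i)) -> <<s S >> [set w | forall i, F i w].
Proof.
move=> SF.
have h : @measurable _ (g_sigma_algebraType S) (\bigcap_(i in [set: I]) F i).
  by apply: fin_bigcap_measurable => [|i _]; [exact: finite_finset|exact: SF].
by rewrite (_ : [set w | _] = \bigcap_(i in [set: I]) F i) //; apply/seteqP;
  split=> w /= hw i => [_|]; exact: hw.
Qed.

Lemma mutually_independentT (I : finType) (F : I -> set (set T)) (E : I -> set T) :
  mutually_independent P F -> (forall i, F i (E i)) ->
  P [set w | forall i, E i w] = (\prod_i P (E i))%E.
Proof.
move=> ind FE; have := ind [set: I]%SET E (fun i _ => FE i).
rewrite (_ : \bigcap_(i in _) E i = [set w | forall i, E i w]); last first.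
  apply/seteqP; split=> w /= h i; last by move=> _; exact: h.
  by apply: h; rewrite /= inE.
by move=> ->; apply: eq_bigl => i; rewrite inE.
Qed.

Lemma rv_sigma_event (f : T -> R) (B : set R) : measurable B ->
  rv_sigma f [set w | B (f w)].
Proof. by move=> mB; exists B => //; rewrite setTI. Qed.

Lemma mx_sigma_event m n (V : T -> 'M[R]_(m, n)) (B : 'I_m * 'I_n -> set R) :
  (forall ij, measurable (B ij)) ->
  mx_sigma V [set w | forall ij, B ij (V w ij.1 ij.2)].
Proof.
move=> mB; apply: (sigma_fin_bigcap (F := fun ij w => B ij (V w ij.1 ij.2))) => ij.
by apply: sub_sigma_algebra; exists ij => //; exact: rv_sigma_event.
Qed.

Lemma isotropic_family (s : R) k (V : T -> 'cV[R]_k) : isotropic_normal P s V ->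
  indep_normal (fun=> s) P (fun w j => V w j 0).
Proof.
move=> [nV iV]; split=> [j|B mB]; first by case: (nV j).
rewrite (mutually_independentT (E := fun j => [set w | B j (V w j 0)]) iV).
  by apply: eq_bigr => j _; have [_] := nV j; apply.
by move=> j; exact: rv_sigma_event.
Qed.

(** Independence between rows and independence within each row give together
    independence of all the entries. *)
Lemma normal_rows_family m n (V : T -> 'M[R]_(m, n)) :
  independent_std_normal_rows P V ->
  indep_normal (fun=> 1) P (fun w ij => V w ij.1 ij.2).
Proof.
move=> [nV iV]; have fam i := isotropic_family (nV i).
split=> [[i j]|B mB] /=.
  have := (fam i).1 j; congr measurable_fun.
  by apply/funext => w; rewrite !mxE.
pose E i := [set w | forall j, B (i, j) ((row i (V w))^T j 0)].
have -> : [set w | forall ij, B ij (V w ij.1 ij.2)] = [set w | forall i, E i w].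
  apply/seteqP; split=> w /= h; first by move=> i j; have := h (i, j); rewrite !mxE.
  by move=> [i j]; have := h i j; rewrite !mxE.
rewrite (mutually_independentT iV) => [|i].
  transitivity (\prod_i \prod_j normal_prob 0 1 (B (i, j)))%E.
    by apply: eq_bigr => i _; exact: ((fam i).2 (fun j => B (i, j))).
  by rewrite pair_big; apply: eq_bigr => -[i j] _.
rewrite /E (_ : [set w | _] =
    [set w | forall ij : 'I_1 * 'I_n, B (i, ij.2) (row i (V w) ij.1 ij.2)]).
  by apply: (@mx_sigma_event _ _ (fun w => row i (V w)) (fun ij => B (i, ij.2))).
apply/seteqP; split=> w /= h; first by move=> [k j]; have := h j; rewrite !mxE ord1.
by move=> j; have := h (0, j); rewrite !mxE.
Qed.

Variables (n0 m d0 : nat) (sigma : R).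

(** All the scalars of the model form a single family, so that the whole independence
    hypothesis becomes one product formula. *)
Definition model_index : finType :=
  (('I_n0 * 'I_d0) + 'I_n0 + ('I_m * 'I_d0) + 'I_d0 + 'I_1)%type.

Definition idx_X ij : model_index := inl (inl (inl (inl ij))).
Definition idx_e i : model_index := inl (inl (inl (inr i))).
Definition idx_W ij : model_index := inl (inl (inr ij)).
Definition idx_x j : model_index := inl (inr j).
Definition idx_e' : model_index := inr ord0.

Definition model_scale (i : model_index) : R :=
  match i with
  | inl (inl (inl (inr _))) | inr _ => sigma
  | _ => 1
  end.

Definition model_family (X : T -> 'M[R]_(n0, d0)) (e : T -> 'cV[R]_n0)
    (W : T -> 'M[R]_(m, d0)) (x' : T -> 'cV[R]_d0) (e' : T -> R) (w : T)
    (i : model_index) : R :=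
  match i with
  | inl (inl (inl (inl ij))) => X w ij.1 ij.2
  | inl (inl (inl (inr i))) => e w i 0
  | inl (inl (inr ij)) => W w ij.1 ij.2
  | inl (inr j) => x' w j 0
  | inr _ => e' w
  end.

Lemma big_model_index (S : Type) (idx : S) (op : Monoid.com_law idx)
    (F : model_index -> S) :
  \big[op/idx]_i F i =
  op (op (op (op (\big[op/idx]_ij F (idx_X ij)) (\big[op/idx]_i F (idx_e i)))
     (\big[op/idx]_ij F (idx_W ij))) (\big[op/idx]_j F (idx_x j))) (F idx_e').
Proof. by rewrite !big_sumType /= big_ord1. Qed.

Lemma data_model_family (X : T -> 'M[R]_(n0, d0)) (e : T -> 'cV[R]_n0)
    (W : T -> 'M[R]_(m, d0)) (x' : T -> 'cV[R]_d0) (e' : T -> R) :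
  data_model P sigma X e W x' e' ->
  indep_normal model_scale P (model_family X e W x' e').
Proof.
move=> [hX he hW [hx he'] ind].
have fX := normal_rows_family hX; have fe := isotropic_family he.
have fW := normal_rows_family hW; have fx := isotropic_family hx.
split.
  move=> [[[[ij|i]|ij]|j]|i] /=.
  - exact: fX.1.
  - exact: fe.1.
  - exact: fW.1.
  - exact: fx.1.
  - by case: he'.
move=> B mB.
pose E (k : 'I_5) : set T := nth setT
  [:: [set w | forall ij, B (idx_X ij) (X w ij.1 ij.2)];
      [set w | forall i, B (idx_e i) (e w i 0)];
      [set w | forall ij, B (idx_W ij) (W w ij.1 ij.2)];
      [set w | forall j, B (idx_x j) (x' w j 0)];
      [set w | B idx_e' (e' w)]] k.
have -> : [set w | forall i, B i (model_family X e W x' e' w i)] =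
    [set w | forall k, E k w].
  apply/seteqP; split=> w /= h.
    move=> [] [|[|[|[|[|k]]]]] // lt; rewrite /E /=.
    - by move=> ij; exact: (h (idx_X ij)).
    - by move=> i; exact: (h (idx_e i)).
    - by move=> ij; exact: (h (idx_W ij)).
    - by move=> j; exact: (h (idx_x j)).
    - exact: (h idx_e').
  move=> [[[[ij|i]|ij]|j]|i] /=.
  - exact: (h ord0 ij).
  - exact: (h (@Ordinal 5 1 isT) i).
  - exact: (h (@Ordinal 5 2 isT) ij).
  - exact: (h (@Ordinal 5 3 isT) j).
  - by rewrite [i]ord1; exact: (h (@Ordinal 5 4 isT)).
have colev k (V : T -> 'cV[R]_k) (C : 'I_k -> set R) : (forall j, measurable (C j)) ->
    mx_sigma V [set w | forall j, C j (V w j 0)].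
  move=> mC; rewrite (_ : [set w | _] =
      [set w | forall ij : 'I_k * 'I_1, C ij.1 (V w ij.1 ij.2)]).
    exact: (@mx_sigma_event _ _ V (fun ij => C ij.1)).
  apply/seteqP; split=> w /= h; first by move=> [a b]; rewrite ord1; exact: h.
  by move=> j; exact: (h (j, 0)).
rewrite (mutually_independentT (E := E) ind); last first.
  move=> [] [|[|[|[|[|k]]]]] // lt; rewrite /E /=.
  - exact: (@mx_sigma_event _ _ X (fun ij => B (idx_X ij))).
  - exact: (@colev _ e (fun i => B (idx_e i))).
  - exact: (@mx_sigma_event _ _ W (fun ij => B (idx_W ij))).
  - exact: (@colev _ x' (fun i => B (idx_x i))).
  - exact: rv_sigma_event.
rewrite big_model_index !big_ord_recl big_ord0 /E /= mule1 !muleA.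
congr (_ * _ * _ * _ * _)%E.
- exact: (fX.2 (fun ij => B (idx_X ij))).
- exact: (fe.2 (fun i => B (idx_e i))).
- exact: (fW.2 (fun ij => B (idx_W ij))).
- exact: (fx.2 (fun i => B (idx_x i))).
- by have [_ h] := he'; exact: h.
Qed.

End DataModelFamily.

Arguments idx_X {n0 m d0} ij.
Arguments idx_e {n0 m d0} i.
Arguments idx_W {n0 m d0} ij.
Arguments idx_x {n0 m d0} j.
Arguments idx_e' {n0 m d0}.

(** * The estimator as a matrix applied to the responses *)

Section LinearEstimator.
Context {R : realType}.

(** The estimator is linear in the responses, both above and below the
    interpolation threshold. *)
Definition fit_mx (n d : nat) (D : 'M[R]_(n, d)) : 'M[R]_(d, n) :=
  if (d <= n)%N then invmx (D^T *m D) *m D^T else D^T *m invmx (D *m D^T).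

Lemma estimatorE (n d : nat) (D : 'M[R]_(n, d)) (u : 'cV[R]_n) :
  estimator D u = fit_mx D *m u.
Proof. by rewrite /estimator /fit_mx; case: ifP. Qed.

(** The matrix sending the responses of the sample to those of the training set. *)
Definition train_mx (n0 n : nat) : 'M[R]_(n, n0) :=
  rowsub (widen_ord (leq_train n0 n)) (col_mx 1%:M (0 : 'M[R]_(n - n0, n0))).

Lemma train_responseE (n0 n : nat) (y : 'cV[R]_n0) :
  train_response n y = train_mx n0 n *m y.
Proof.
rewrite /train_response /train_mx mul_rowsub_mx mul_col_mx mul1mx mul0mx //.
Qed.

Lemma measurable_train_design d (T : measurableType d) (n0 d0 n : nat)
    (X : T -> 'M[R]_(n0, d0)) (W : T -> 'M[R]_(n - n0, d0)) :
  measurable_mx X -> measurable_mx W ->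
  measurable_mx (fun w => train_design (X w) (W w)).
Proof.
move=> mX mW i j.
have [k E|k E] := split_ordP (widen_ord (leq_train n0 n) i).
  have -> : (fun w => train_design (X w) (W w) i j) = (fun w => X w k j).
    by apply/funext => w; rewrite mxE E col_mxEu.
  exact: mX.
have -> : (fun w => train_design (X w) (W w) i j) = (fun w => W w k j).
  by apply/funext => w; rewrite mxE E col_mxEd.
exact: mW.
Qed.

Lemma measurable_fit_mx d (T : measurableType d) (n d0 : nat) (D : T -> 'M[R]_(n, d0)) :
  measurable_mx D -> measurable_mx (fun w => fit_mx (D w)).
Proof.
move=> mD; have mDT : measurable_mx (fun w => (D w)^T) by exact: measurable_mxT.
rewrite /fit_mx; case: (d0 <= n)%N; apply: measurable_mxM => //;
  by apply: measurable_invmx; apply: measurable_mxM.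
Qed.

End LinearEstimator.

(** * Averaging over the test point and the noise *)

Section Risk.
Context {R : realType} (dsp : measure_display) (T : measurableType dsp)
  (P : probability T R).
Variables (n0 m d0 : nat) (sigma : R).
Hypothesis sigma0 : sigma != 0.
Variables (Z : T -> model_index n0 m d0 -> R).
Hypothesis hZ : indep_normal (model_scale sigma) P Z.

Definition model_X (z : model_index n0 m d0 -> R) : 'M[R]_(n0, d0) := \matrix_(i, j) z (idx_X (i, j)).
Definition model_e (z : model_index n0 m d0 -> R) : 'cV[R]_n0 := \col_i z (idx_e i).
Definition model_W (z : model_index n0 m d0 -> R) : 'M[R]_(m, d0) := \matrix_(i, j) z (idx_W (i, j)).
Definition model_x (z : model_index n0 m d0 -> R) : 'cV[R]_d0 := \col_j z (idx_x j).

Local Notation F := (family R (model_index n0 m d0)).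

Lemma measurable_model_X : measurable_mx (model_X : F -> _).
Proof.
move=> i j; have -> : (fun z : F => model_X z i j) = (fun z => z (idx_X (i, j))).
  by apply/funext => z; rewrite mxE.
exact: measurable_coord.
Qed.

Lemma measurable_model_e : measurable_mx (model_e : F -> _).
Proof.
move=> i j; have -> : (fun z : F => model_e z i j) = (fun z => z (idx_e i)).
  by apply/funext => z; rewrite mxE.
exact: measurable_coord.
Qed.

Lemma measurable_model_W : measurable_mx (model_W : F -> _).
Proof.
move=> i j; have -> : (fun z : F => model_W z i j) = (fun z => z (idx_W (i, j))).
  by apply/funext => z; rewrite mxE.
exact: measurable_coord.
Qed.

Lemma measurable_model_x : measurable_mx (model_x : F -> _).
Proof.
move=> i j; have -> : (fun z : F => model_x z i j) = (fun z => z (idx_x i)).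
  by apply/funext => z; rewrite mxE.
exact: measurable_coord.
Qed.

Let scale0 (i : model_index n0 m d0) : model_scale sigma i != 0 :> R.
Proof. by move: i => [[[[ij|i]|ij]|j]|i] //=; exact: oner_neq0. Qed.

Let sum_mul0 (J : finType) (g : J -> R) : \sum_j 0 * g j = 0.
Proof. by apply: big1 => j _; rewrite mul0r. Qed.

Let sum_sqr0_mul (J : finType) (g : J -> R) : \sum_j 0 ^+ 2 * g j = 0.
Proof. by apply: big1 => j _; rewrite expr0n mul0r. Qed.

Lemma integral_noise (c : R) (a : 'cV[R]_n0) :
  (\int[P]_w ((c + \sum_i a i 0 * model_e (Z w) i 0) ^+ 2)%:E =
   (c ^+ 2 + sigma ^+ 2 * \sum_i a i 0 ^+ 2)%:E)%E.
Proof.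
pose a' (i : model_index n0 m d0) := if i is inl (inl (inl (inr k))) then a k 0 else 0.
transitivity (\int[P]_w ((c + \sum_i a' i * Z w i) ^+ 2)%:E)%E.
  apply: eq_integral => w _; congr ((_ + _) ^+ 2)%:E.
  rewrite big_model_index /= !sum_mul0 mul0r !addr0 !add0r.
  by apply: eq_bigr => i _; rewrite mxE.
rewrite (integral_affine_sqr scale0 hZ); congr (_ + _)%:E.
rewrite big_model_index /= !sum_sqr0_mul expr0n mul0r !addr0 !add0r.
by rewrite mulr_sumr; apply: eq_bigr => i _; rewrite mulrC.
Qed.

(** A test point and its noise, drawn independently of an estimation error [v], see
    only the length of [v]. *)
Lemma integral_test_point (v : 'cV[R]_d0) :
  (\int[P]_w ((Z w idx_e' - dotv (model_x (Z w)) v) ^+ 2)%:E =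
   (sigma ^+ 2 + enorm v ^+ 2)%:E)%E.
Proof.
pose a (i : model_index n0 m d0) := match i with
  | inl (inr j) => - v j 0 | inr _ => 1 | _ => 0 end.
transitivity (\int[P]_w ((0 + \sum_i a i * Z w i) ^+ 2)%:E)%E.
  apply: eq_integral => w _; congr (_ ^+ 2)%:E.
  rewrite big_model_index /= mul1r !sum_mul0 !addr0 !add0r.
  rewrite [RHS]addrC /dotv -sumrN; congr (_ + _); apply: eq_bigr => i _.
  by rewrite mxE mulrC mulNr.
rewrite (integral_affine_sqr scale0 hZ) expr0n add0r; congr (_)%:E.
rewrite big_model_index /= expr1n mul1r !sum_sqr0_mul !addr0 !add0r.
rewrite addrC enorm_sqrE; congr (_ + _).
by apply: eq_bigr => i _; rewrite sqrrN mulr1.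
Qed.

Variables (bv : 'M[R]_(n0, d0) -> 'M[R]_(m, d0) -> 'cV[R]_d0)
  (Mv : 'M[R]_(n0, d0) -> 'M[R]_(m, d0) -> 'M[R]_(d0, n0)).
Hypothesis mbv : forall d (U : measurableType d) (A : U -> 'M[R]_(n0, d0))
  (B : U -> 'M[R]_(m, d0)), measurable_mx A -> measurable_mx B ->
  measurable_mx (fun w => bv (A w) (B w)).
Hypothesis mMv : forall d (U : measurableType d) (A : U -> 'M[R]_(n0, d0))
  (B : U -> 'M[R]_(m, d0)), measurable_mx A -> measurable_mx B ->
  measurable_mx (fun w => Mv (A w) (B w)).

Let err (z : F) : 'cV[R]_d0 := bv (model_X z) (model_W z) + Mv (model_X z) (model_W z) *m model_e z.

Let merr : measurable_mx err.
Proof.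
apply: measurable_mxD; first by apply: mbv; [exact: measurable_model_X|exact: measurable_model_W].
apply: measurable_mxM; last exact: measurable_model_e.
by apply: mMv; [exact: measurable_model_X|exact: measurable_model_W].
Qed.

Let mZ : measurable_fun setT (Z : T -> F).
Proof. exact: (measurable_family hZ.1). Qed.

(** The design is frozen first; the error is then affine in the noise. *)
Lemma bias_variance :
  (\int[P]_w (enorm (err (Z w)) ^+ 2)%:E =
   \int[P]_w (enorm (bv (model_X (Z w)) (model_W (Z w))) ^+ 2)%:E +
   (sigma ^+ 2)%:E * \int[P]_w (\tr (Mv (model_X (Z w)) (model_W (Z w)) *m
     (Mv (model_X (Z w)) (model_W (Z w)))^T))%:E)%E.
Proof.
pose f (z : F) : \bar R := (enorm (err z) ^+ 2)%:E.
have mf : measurable_fun setT f by apply/measurable_EFinP; exact: measurable_enorm_sqr.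
have f0 z : (0 <= f z)%E by rewrite lee_fin sqr_ge0.
pose J (i : model_index n0 m d0) := if i is inl (inl (inl (inr _))) then false else true.
rewrite (ge0_integral_mix J hZ hZ mf f0).
have mXZ : measurable_mx (fun w => model_X (Z w)).
  by move=> i j; exact: (measurableT_comp (measurable_model_X i j) mZ).
have mWZ : measurable_mx (fun w => model_W (Z w)).
  by move=> i j; exact: (measurableT_comp (measurable_model_W i j) mZ).
have mb : measurable_mx (fun w => bv (model_X (Z w)) (model_W (Z w))) by exact: mbv.
have mM : measurable_mx (fun w => Mv (model_X (Z w)) (model_W (Z w))) by exact: mMv.
have mt : measurable_fun setT (fun w => \tr (Mv (model_X (Z w)) (model_W (Z w)) *m
     (Mv (model_X (Z w)) (model_W (Z w)))^T)).
  by apply: measurable_tr; apply: measurable_mxM => //; exact: measurable_mxT.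
rewrite -ge0_integralZl //; last 3 first.
- by apply/measurable_EFinP.
- by move=> w _; rewrite lee_fin mxtrace_mulT_ge0.
- by rewrite lee_fin sqr_ge0.
rewrite -ge0_integralD //; last 4 first.
- by move=> w _; rewrite lee_fin sqr_ge0.
- by apply/measurable_EFinP; exact: measurable_enorm_sqr.
- by move=> w _; rewrite mule_ge0 // lee_fin ?sqr_ge0 // mxtrace_mulT_ge0.
- by apply: emeasurable_funM => //; apply/measurable_EFinP.
apply: eq_integral => w1 _.
set b := bv _ _; set M := Mv _ _.
transitivity (\int[P]_w2 \sum_k ((b k 0 + \sum_i (row k M)^T i 0 * model_e (Z w2) i 0) ^+ 2)%:E)%E.
  apply: eq_integral => w2 _; rewrite sumEFin /f enorm_sqrE; congr _%:E.
  apply: eq_bigr => k _; congr (_ ^+ 2).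
  set z := fun i => _.
  have -> : err z = b + M *m model_e (Z w2).
    rewrite /err (_ : model_X z = model_X (Z w1)); last by apply/matrixP => i j; rewrite !mxE.
    rewrite (_ : model_W z = model_W (Z w1)); last by apply/matrixP => i j; rewrite !mxE.
    by rewrite (_ : model_e z = model_e (Z w2)) //; apply/matrixP => i j; rewrite !mxE.
  rewrite mxE; congr (_ + _); rewrite mxE; apply: eq_bigr => i _.
  by congr (_ * _); rewrite !mxE.
rewrite ge0_integral_sum //; last 2 first.
- move=> k; apply/measurable_EFinP; apply: measurable_funX; apply: measurable_funD => //.
  apply: measurable_sum_fun => i; apply: measurable_funM => //.
  exact: (measurableT_comp (measurable_model_e i 0) mZ).
- by move=> k w _; rewrite lee_fin sqr_ge0.
under eq_bigr do rewrite integral_noise.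
rewrite sumEFin big_split /= -enorm_sqrE -mulr_sumr -EFinM -EFinD; congr (_ + _ * _)%:E.
rewrite mxtrace_mulT; apply: eq_bigr => k _; apply: eq_bigr => i _.
by rewrite !mxE.
Qed.

Lemma risk_decomposition :
  (\int[P]_w ((Z w idx_e' - dotv (model_x (Z w)) (err (Z w))) ^+ 2)%:E =
   (sigma ^+ 2)%:E +
   \int[P]_w (enorm (bv (model_X (Z w)) (model_W (Z w))) ^+ 2)%:E +
   (sigma ^+ 2)%:E * \int[P]_w (\tr (Mv (model_X (Z w)) (model_W (Z w)) *m
     (Mv (model_X (Z w)) (model_W (Z w)))^T))%:E)%E.
Proof.
pose f (z : F) : \bar R := ((z idx_e' - dotv (model_x z) (err z)) ^+ 2)%:E.
have mf : measurable_fun setT f.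
  apply/measurable_EFinP; apply: measurable_funX; apply: measurable_funB.
    exact: measurable_coord.
  by apply: measurable_dotv => //; exact: measurable_model_x.
have f0 z : (0 <= f z)%E by rewrite lee_fin sqr_ge0.
pose J (i : model_index n0 m d0) := if i is inl (inl _) then true else false.
rewrite (ge0_integral_mix J hZ hZ mf f0) -addeA -bias_variance.
have mE : measurable_fun setT (fun w => (enorm (err (Z w)) ^+ 2)%:E).
  apply/measurable_EFinP; apply: measurable_enorm_sqr => i j.
  exact: (measurableT_comp (merr i j) mZ).
rewrite -[X in (X + _)%E](integral_prob_cst P) -ge0_integralD //; last 2 first.
- by move=> w _; rewrite lee_fin sqr_ge0.
- by move=> w _; rewrite lee_fin sqr_ge0.
apply: eq_integral => w1 _; rewrite -EFinD -integral_test_point.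
apply: eq_integral => w2 _; rewrite /f.
set z := fun i => _.
have -> // : err z = err (Z w1).
  rewrite /err (_ : model_X z = model_X (Z w1)); last by apply/matrixP => i j; rewrite !mxE.
  rewrite (_ : model_W z = model_W (Z w1)); last by apply/matrixP => i j; rewrite !mxE.
  by rewrite (_ : model_e z = model_e (Z w1)) //; apply/matrixP => i j; rewrite !mxE.
Qed.

End Risk.

(** * Training designs with and without noise observations *)

Section TrainingMatrices.
Context {R : realType}.

(** With noise observations the training matrices are indexed by [n], which is only
    provably equal to the number of rows of the stacked matrix. *)
Lemma rowsub_widen_id (N d n : nat) (hle : (n <= N)%N) (h : n = N) (A : 'M[R]_(N, d)) :
  rowsub (widen_ord hle) A = castmx (esym h, erefl d) A.
Proof.
case: N / h hle A => hle A; rewrite castmx_id; apply/matrixP => i j.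
by rewrite mxE; congr (A _ _); apply: val_inj.
Qed.

Lemma min_norm_rowsub (N d k n : nat) (hle : (n <= N)%N) (h : n = N) (A : 'M[R]_(N, d))
    (J : 'M[R]_(N, k)) :
  let D := rowsub (widen_ord hle) A in
  D^T *m invmx (D *m D^T) *m rowsub (widen_ord hle) J =
  A^T *m invmx (A *m A^T) *m J.
Proof.
rewrite /= !(rowsub_widen_id _ h).
by case: N / h hle A J => hle A J; rewrite !castmx_id.
Qed.

Lemma gram_rowsub_unit (N d n : nat) (hle : (n <= N)%N) (h : n = N) (A : 'M[R]_(N, d)) :
  let D := rowsub (widen_ord hle) A in
  (D *m D^T \in unitmx) = (A *m A^T \in unitmx).
Proof.
rewrite /= !(rowsub_widen_id _ h).
by case: N / h hle A => hle A; rewrite !castmx_id.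
Qed.

Lemma ols_rowsub (N d k n : nat) (hle : (n <= N)%N) (h : n = N) (A : 'M[R]_(N, d))
    (J : 'M[R]_(N, k)) :
  let D := rowsub (widen_ord hle) A in
  invmx (D^T *m D) *m D^T *m rowsub (widen_ord hle) J =
  invmx (A^T *m A) *m A^T *m J.
Proof.
rewrite /= !(rowsub_widen_id _ h).
by case: N / h hle A J => hle A J; rewrite !castmx_id.
Qed.

Lemma train_mx_design (n0 d n : nat) (X : 'M[R]_(n0, d)) (W : 'M[R]_(n - n0, d)) :
  (n <= n0)%N -> train_mx n0 n *m X = train_design X W.
Proof.
move=> le_n; rewrite /train_mx /train_design mul_rowsub_mx mul_col_mx mul1mx mul0mx.
apply/matrixP => i j; rewrite mxE [RHS]mxE.
have -> : widen_ord (leq_train n0 n) i = lshift (n - n0) (widen_ord le_n i).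
  exact: val_inj.
by rewrite !col_mxEu.
Qed.

(** The first rows of an identity matrix are orthonormal. *)
Lemma train_mx_orth (n0 n : nat) : (n <= n0)%N ->
  train_mx n0 n *m (train_mx n0 n)^T = 1%:M :> 'M[R]_n.
Proof.
move=> le_n; have tE i j : train_mx n0 n i j = (widen_ord le_n i == j)%:R :> R.
  rewrite /train_mx mxE.
  have -> : widen_ord (leq_train n0 n) i = lshift (n - n0) (widen_ord le_n i).
    exact: val_inj.
  by rewrite col_mxEu mxE.
apply/matrixP => i j; rewrite mxE (bigD1 (widen_ord le_n i)) //= big1 ?addr0.
  rewrite tE eqxx mul1r mxE tE mxE; congr (_%:R); rewrite eq_sym.
  by rewrite -(inj_eq val_inj).
by move=> k; rewrite eq_sym tE => /negbTE ->; rewrite mul0r.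
Qed.

Section Block.
Variables (n0 m d : nat) (X : 'M[R]_(n0, d)) (W : 'M[R]_(m, d)).
Local Notation K := (X *m X^T - X *m W^T *m invmx (W *m W^T) *m W *m X^T).

Lemma schur_sym : K^T = K.
Proof.
rewrite linearB /= !trmx_mul !trmxK trmx_inv trmx_mul trmxK.
by rewrite !mulmxA.
Qed.

Lemma A11_sym : (A11 X W)^T = A11 X W.
Proof. by rewrite /A11 trmx_inv schur_sym. Qed.

Hypothesis uW : W *m W^T \in unitmx.
Hypothesis uA : col_mx X W *m (col_mx X W)^T \in unitmx.

Lemma gram_col_mx : col_mx X W *m (col_mx X W)^T =
  block_mx (X *m X^T) (X *m W^T) (W *m X^T) (W *m W^T).
Proof. by rewrite tr_col_mx mul_col_row. Qed.

(** A row vector killed by the Schur complement extends to one killed by the whole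
    Gram matrix. *)
Lemma schur_unit : K \in unitmx.
Proof.
rewrite -row_free_unit; apply: inj_row_free => v vK.
pose u := row_mx v (- (v *m X *m W^T *m invmx (W *m W^T))).
suff u0 : u = 0.
  have : lsubmx u = 0 by rewrite u0; apply/matrixP => i j; rewrite !mxE.
  by rewrite /u row_mxKl.
have h : u *m (col_mx X W *m (col_mx X W)^T) = 0.
  rewrite gram_col_mx /u mul_row_block !mulNmx -!mulmxA.
  rewrite [invmx _ *m (W *m W^T)]mulVmx // mulmx1 !mulmxA subrr.
  move: vK; rewrite mulmxBr !mulmxA => ->.
  exact: row_mx0.
by rewrite -[u](mulmxK uA) h mul0mx.
Qed.

(** Block elimination: the product of the Gram matrix and the claimed columns is the
    first block of columns of the identity. *)
Lemma gram_inv_first_block :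
  invmx (col_mx X W *m (col_mx X W)^T) *m col_mx 1%:M 0 =
  col_mx (A11 X W) (A21 X W).
Proof.
apply: (can_inj (mulKmx uA)); rewrite mulKVmx // gram_col_mx mul_block_col.
rewrite /A21 !mulmxN; congr col_mx.
  rewrite !mulmxA -mulmxBl /A11; apply/esym; exact: (mulmxV schur_unit).
by rewrite !mulmxA mulmxV // mul1mx subrr.
Qed.

End Block.
End TrainingMatrices.

Section MeasurableBlocks.
Context {R : realType} d (T : measurableType d) (n0 m d0 : nat)
  (X : T -> 'M[R]_(n0, d0)) (W : T -> 'M[R]_(m, d0)).
Hypotheses (mX : measurable_mx X) (mW : measurable_mx W).

Let mXT : measurable_mx (fun w => (X w)^T). Proof. exact: measurable_mxT. Qed.
Let mWT : measurable_mx (fun w => (W w)^T). Proof. exact: measurable_mxT. Qed.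

Let mVW : measurable_mx (fun w => invmx (W w *m (W w)^T)).
Proof. by apply: measurable_invmx; exact: measurable_mxM. Qed.

Lemma measurable_A11 : measurable_mx (fun w => A11 (X w) (W w)).
Proof.
by apply: measurable_invmx; apply: measurable_mxB; do ?apply: measurable_mxM.
Qed.

Lemma measurable_A21 : measurable_mx (fun w => A21 (X w) (W w)).
Proof.
have h : measurable_mx (fun w =>
    invmx (W w *m (W w)^T) *m W w *m (X w)^T *m A11 (X w) (W w)).
  by do ?apply: measurable_mxM => //; exact: measurable_A11.
move=> i j; have -> : (fun w => A21 (X w) (W w) i j) = (fun w =>
    - (invmx (W w *m (W w)^T) *m W w *m (X w)^T *m A11 (X w) (W w)) i j).
  by apply/funext => w; rewrite mxE.
exact: measurableT_comp (h i j).
Qed.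

End MeasurableBlocks.

(** * The test error *)

Section TestError.
Context {R : realType} (dsp : measure_display) (T : measurableType dsp)
  (P : probability T R).
Variables (n0 d0 : nat) (beta0 : 'cV[R]_d0) (sigma : R) (sigma0 : sigma != 0)
  (X : T -> 'M[R]_(n0, d0)) (e : T -> 'cV[R]_n0) (n : nat)
  (W : T -> 'M[R]_(n - n0, d0)) (x' : T -> 'cV[R]_d0) (e' : T -> R).
Hypothesis hmodel : data_model P sigma X e W x' e'.

Local Notation D w := (train_design (X w) (W w)).
Local Notation M w := (fit_mx (D w) *m train_mx n0 n).
Let Z := model_family X e W x' e'.
Let hZ : indep_normal (model_scale sigma) P Z := data_model_family hmodel.

Let zXE w : model_X (Z w) = X w. Proof. by apply/matrixP => i j; rewrite mxE. Qed.
Let zWE w : model_W (Z w) = W w. Proof. by apply/matrixP => i j; rewrite mxE. Qed.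
Let zxE w : model_x (Z w) = x' w. Proof. by apply/matrixP => i j; rewrite mxE ord1. Qed.
Let zeE w : model_e (Z w) = e w. Proof. by apply/matrixP => i j; rewrite mxE ord1. Qed.

Lemma measurable_X : measurable_mx X.
Proof. by move=> i j; exact: (hZ.1 (idx_X (i, j))). Qed.

Lemma measurable_W : measurable_mx W.
Proof. by move=> i j; exact: (hZ.1 (idx_W (i, j))). Qed.

Lemma measurable_D : measurable_mx (fun w => D w).
Proof. exact: measurable_train_design measurable_X measurable_W. Qed.

(** [M w] is the matrix of the fit on the sample responses, so the estimation error is
    [(M X - 1) beta0 + M e]. *)
Theorem test_error_decomposition :
  (test_error P beta0 X e W x' e' = (sigma ^+ 2)%:E +
   \int[P]_w (enorm ((M w *m X w - 1%:M) *m beta0) ^+ 2)%:E +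
   (sigma ^+ 2)%:E * \int[P]_w (\tr (M w *m (M w)^T))%:E)%E.
Proof.
pose Mv (A : 'M[R]_(n0, d0)) (B : 'M[R]_(n - n0, d0)) :=
  fit_mx (train_design A B) *m train_mx n0 n.
pose bv A B := (Mv A B *m A - 1%:M) *m beta0.
have mMv : forall d (U : measurableType d) (A : U -> 'M[R]_(n0, d0))
    (B : U -> 'M[R]_(n - n0, d0)), measurable_mx A -> measurable_mx B ->
    measurable_mx (fun w => Mv (A w) (B w)).
  move=> d U A B mA mB; apply: measurable_mxM; last exact: measurable_mx_cst.
  by apply: measurable_fit_mx; exact: measurable_train_design.
have mbv : forall d (U : measurableType d) (A : U -> 'M[R]_(n0, d0))
    (B : U -> 'M[R]_(n - n0, d0)), measurable_mx A -> measurable_mx B ->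
    measurable_mx (fun w => bv (A w) (B w)).
  move=> d U A B mA mB; apply: measurable_mxM; last exact: measurable_mx_cst.
  apply: measurable_mxB; last exact: measurable_mx_cst.
  by apply: measurable_mxM => //; exact: mMv.
have h := risk_decomposition sigma0 hZ mbv mMv.
have i1 : (\int[P]_w (enorm (bv (model_X (Z w)) (model_W (Z w))) ^+ 2)%:E =
    \int[P]_w (enorm ((M w *m X w - 1%:M) *m beta0) ^+ 2)%:E)%E.
  by apply: eq_integral => w _; rewrite zXE zWE.
have i2 : (\int[P]_w (\tr (Mv (model_X (Z w)) (model_W (Z w)) *m (Mv (model_X (Z w)) (model_W (Z w)))^T))%:E =
    \int[P]_w (\tr (M w *m (M w)^T))%:E)%E.
  by apply: eq_integral => w _; rewrite zXE zWE.
rewrite i1 i2 in h; rewrite -h /test_error unlock.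
apply: eq_integral => w _; congr (_ ^+ 2)%:E.
rewrite zXE zWE zxE zeE /betahat estimatorE train_responseE.
have -> : fit_mx (D w) *m (train_mx n0 n *m (X w *m beta0 + e w)) =
    beta0 + (bv (X w) (W w) + Mv (X w) (W w) *m e w).
  rewrite /bv /Mv mulmxBl mul1mx mulmxA mulmxDr !mulmxA addrA [in RHS]addrC.
  by rewrite [in RHS]addrC subrKC.
have -> : Z w idx_e' = e' w by [].
rewrite /dotv addrAC -sumrB addrC /=; congr (_ + _); rewrite -sumrN.
by apply: eq_bigr => i _; rewrite mxE; ring.
Qed.

(** Where each entry of the training design sits in the model. *)
Definition design_index (ij : 'I_n * 'I_d0) : model_index n0 (n - n0) d0 :=
  match fintype.split (widen_ord (leq_train n0 n) ij.1) with
  | inl k => idx_X (k, ij.2)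
  | inr k => idx_W (k, ij.2)
  end.

Lemma design_index_inj : injective design_index.
Proof.
move=> [i j] [k l]; rewrite /design_index /=.
case: split_ordP => a Ea; case: split_ordP => b Eb //= [ab ->].
  have E : widen_ord (leq_train n0 n) i = widen_ord (leq_train n0 n) k.
    by rewrite Ea Eb ab.
  by congr (_, _); apply: val_inj; exact: (congr1 val E).
have E : widen_ord (leq_train n0 n) i = widen_ord (leq_train n0 n) k.
  by rewrite Ea Eb ab.
by congr (_, _); apply: val_inj; exact: (congr1 val E).
Qed.

Lemma designE w : D w = family_mx (fun ij => Z w (design_index ij)).
Proof.
apply/matrixP => i j; rewrite mxE [RHS]mxE /design_index /=.
by case: split_ordP => k ->; rewrite ?col_mxEu ?col_mxEd.
Qed.

Lemma design_family : indep_normal (fun=> 1) P (fun w ij => Z w (design_index ij)).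
Proof.
have E : (fun=> 1) = model_scale sigma \o design_index.
  by apply/funext => -[i j]; rewrite /= /design_index /=; case: split_ordP.
rewrite E; exact: indep_normal_reindex design_index_inj hZ.
Qed.

Lemma design_trans_family :
  indep_normal (fun=> 1) P (fun w (ji : 'I_d0 * 'I_n) => Z w (design_index (ji.2, ji.1))).
Proof.
have sw : injective (fun ji : 'I_d0 * 'I_n => (ji.2, ji.1)).
  by move=> [a b] [c f] [-> ->].
exact: indep_normal_reindex sw design_family.
Qed.

Lemma design_transE w :
  (D w)^T = family_mx (fun ji : 'I_d0 * 'I_n => Z w (design_index (ji.2, ji.1))).
Proof. by rewrite designE; apply/matrixP => i j; rewrite !mxE. Qed.

Lemma noise_design_family : indep_normal (fun=> 1) P (fun w ij => Z w (idx_W ij)).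
Proof.
have inj : injective (@idx_W n0 (n - n0) d0) by move=> ? ? [].
exact: indep_normal_reindex inj hZ.
Qed.

Lemma noise_designE w : W w = family_mx (fun ij => Z w (idx_W ij)).
Proof. by apply/matrixP => i j; rewrite mxE. Qed.

Lemma ae_design_gram : (n <= d0)%N -> {ae P, forall w, D w *m (D w)^T \in unitmx}.
Proof.
move=> h; apply: filterS (gaussian_gram_unit h design_family) => w.
by rewrite designE.
Qed.

Lemma ae_design_gram_tr : (d0 <= n)%N -> {ae P, forall w, (D w)^T *m D w \in unitmx}.
Proof.
move=> h; apply: filterS (gaussian_gram_unit h design_trans_family) => w.
by rewrite -design_transE trmxK.
Qed.

Lemma ae_noise_gram : (n - n0 <= d0)%N -> {ae P, forall w, W w *m (W w)^T \in unitmx}.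
Proof.
move=> h; apply: filterS (gaussian_gram_unit h noise_design_family) => w.
by rewrite -noise_designE.
Qed.

Let mM : measurable_mx (fun w => M w).
Proof.
apply: measurable_mxM; last exact: measurable_mx_cst.
exact: measurable_fit_mx measurable_D.
Qed.

Lemma measurable_variance : measurable_fun setT (fun w => (\tr (M w *m (M w)^T))%:E).
Proof.
apply/measurable_EFinP; apply: measurable_tr; apply: measurable_mxM => //.
exact: measurable_mxT.
Qed.

Lemma measurable_bias : measurable_fun setT
  (fun w => (enorm ((M w *m X w - 1%:M) *m beta0) ^+ 2)%:E).
Proof.
apply/measurable_EFinP; apply: measurable_enorm_sqr; apply: measurable_mxM.
  apply: measurable_mxB; last exact: measurable_mx_cst.
  by apply: measurable_mxM => //; exact: measurable_X.
exact: measurable_mx_cst.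
Qed.

Lemma tr_fit_train w : (n <= n0)%N ->
  \tr (M w *m (M w)^T) = \tr (fit_mx (D w) *m (fit_mx (D w))^T).
Proof.
move=> h; rewrite trmx_mul !mulmxA -[fit_mx _ *m train_mx _ _ *m _]mulmxA.
by rewrite train_mx_orth // mulmx1.
Qed.

(** An interpolating design loses the projection of [beta0] on its kernel and amplifies
    the noise by the trace of the inverse of [D D^T]. *)
Lemma test_error_few_rows : (n <= n0)%N -> (0 < n)%N -> (n < d0)%N ->
  (test_error P beta0 X e W x' e' = (sigma ^+ 2)%:E +
    (enorm beta0 ^+ 2 * (1 - n%:R / d0%:R))%:E +
    (sigma ^+ 2)%:E * (if (n + 2 <= d0)%N then (n%:R / (d0%:R - n%:R - 1))%:E
      else +oo))%E.
Proof.
move=> nn0 n_gt0 nd; have nd' := ltnW nd.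
rewrite test_error_decomposition; congr (_ + _ + _ * _)%E.
- rewrite -(expected_proj_defect design_family nd' beta0 (leq_ltn_trans (leq0n _) nd)).
  apply: eq_integral => w _; rewrite -designE -mulmxA (train_mx_design _ (W w)) //.
  by rewrite /fit_mx leqNgt nd /= /proj_defect.
- rewrite -(expected_trace_inverse design_family nd' n_gt0).
  apply: ae_eq_integral => //.
  + exact: measurable_variance.
  + apply/measurable_EFinP; apply: measurable_tr_invmx_gram.
    have -> : (fun w => family_mx (fun ij => Z w (design_index ij))) = (fun w => D w).
      by apply/funext => w; rewrite designE.
    exact: measurable_D.
  + apply: filterS (ae_design_gram nd') => w uw _.
    rewrite -designE tr_fit_train // /fit_mx leqNgt nd /= trmx_mul trmxK.
    rewrite mxtrace_mulC gram_inv_sym // !mulmxA -[_ *m D w *m _]mulmxA.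
    by rewrite mulVmx // mul1mx.
Qed.

(** Least squares on uncorrupted data is unbiased, and [D^T] is a Gaussian matrix
    with at least as many columns as rows. *)
Lemma test_error_many_rows : (n <= n0)%N -> (0 < d0)%N -> (d0 <= n)%N ->
  (test_error P beta0 X e W x' e' = (sigma ^+ 2)%:E +
    (sigma ^+ 2)%:E * (if (d0 + 2 <= n)%N then (d0%:R / (n%:R - d0%:R - 1))%:E
      else +oo))%E.
Proof.
move=> nn0 d_gt0 dn.
(* The bias vanishes wherever [D^T D] is invertible. *)
have bias0 : (\int[P]_w (enorm ((M w *m X w - 1%:M) *m beta0) ^+ 2)%:E = 0)%E.
  rewrite -(integral0 P setT); apply: ae_eq_integral => //; first exact: measurable_bias.
  apply: filterS (ae_design_gram_tr dn) => w uw _.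
  rewrite -mulmxA (train_mx_design _ (W w)) // /fit_mx dn -mulmxA mulVmx // subrr mul0mx.
  by rewrite enorm_sqrE big1 // => i _; rewrite mxE expr0n.
rewrite test_error_decomposition bias0 adde0; congr (_ + _ * _)%E.
- rewrite -(expected_trace_inverse design_trans_family dn d_gt0).
  apply: ae_eq_integral => //.
  + exact: measurable_variance.
  + apply/measurable_EFinP; apply: measurable_tr_invmx_gram.
    have -> : (fun w => family_mx (fun ji : 'I_d0 * 'I_n =>
        Z w (design_index (ji.2, ji.1)))) = (fun w => (D w)^T).
      by apply/funext => w; rewrite design_transE.
    exact: measurable_mxT measurable_D.
  + apply: filterS (ae_design_gram_tr dn) => w uw _.
    rewrite -design_transE trmxK tr_fit_train // /fit_mx dn trmx_mul trmxK.
    by rewrite !mulmxA -[_ *m (D w)^T *m D w]mulmxA mulVmx // mul1mx trmx_inv trmx_mul trmxK.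
Qed.

Lemma train_size : (n0 <= n)%N -> n = (n0 + (n - n0))%N.
Proof. by move=> h; rewrite subnKC. Qed.

(** The responses of the noise observations are 0, so only the first block of columns
    of the inverse Gram matrix acts. *)
Lemma test_error_noise_min_norm : (n0 <= n)%N -> (n < d0)%N ->
  (test_error P beta0 X e W x' e' =
    (sigma ^+ 2)%:E
    + \int[P]_w (enorm (((X w)^T *m A11 (X w) (W w) *m X w
         + (W w)^T *m A21 (X w) (W w) *m X w - 1%:M) *m beta0) ^+ 2)%:E
    + (sigma ^+ 2)%:E * \int[P]_w (
       (let a11 := A11 (X w) (W w) in let a21 := A21 (X w) (W w) in
        \tr (a11 *m X w *m (X w)^T *m a11
             + a21^T *m W w *m (X w)^T *m a11
             + a11 *m X w *m (W w)^T *m a21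
             + a21^T *m W w *m (W w)^T *m a21)))%:E)%E.
Proof.
move=> n0n nd; have hN := train_size n0n.
have mX : measurable_mx X by exact: measurable_X.
have mW : measurable_mx W by exact: measurable_W.
have m11 : measurable_mx (fun w => A11 (X w) (W w)) by exact: measurable_A11.
have m21 : measurable_mx (fun w => A21 (X w) (W w)) by exact: measurable_A21.
have aeM : {ae P, forall w, M w = (X w)^T *m A11 (X w) (W w) + (W w)^T *m A21 (X w) (W w)}.
  have h1 := ae_design_gram (ltnW nd).
  have h2 : {ae P, forall w, W w *m (W w)^T \in unitmx}.
    by apply: ae_noise_gram; rewrite (leq_trans (leq_subr _ _)) // ltnW.
  apply: filterS2 h1 h2 => w; rewrite gram_rowsub_unit // => uA uW.
  rewrite /fit_mx leqNgt nd /= min_norm_rowsub // -mulmxA.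
  by rewrite gram_inv_first_block // tr_col_mx mul_row_col.
have mXT : measurable_mx (fun w => (X w)^T) by exact: measurable_mxT.
have mWT : measurable_mx (fun w => (W w)^T) by exact: measurable_mxT.
have e1 : (\int[P]_w (enorm ((M w *m X w - 1%:M) *m beta0) ^+ 2)%:E =
    \int[P]_w (enorm (((X w)^T *m A11 (X w) (W w) *m X w
         + (W w)^T *m A21 (X w) (W w) *m X w - 1%:M) *m beta0) ^+ 2)%:E)%E.
  apply: ae_eq_integral => //.
  - exact: measurable_bias.
  - apply/measurable_EFinP; apply: measurable_enorm_sqr.
    apply: measurable_mxM; last exact: measurable_mx_cst.
    apply: measurable_mxB; last exact: measurable_mx_cst.
    by apply: measurable_mxD; do ?apply: measurable_mxM.
  - by apply: filterS aeM => w -> _; rewrite (mulmxDl _ _ (X w)).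
rewrite test_error_decomposition e1; congr (_ + _ * _)%E.
apply: ae_eq_integral.
- exact: measurableT.
- exact: measurable_variance.
- apply/measurable_EFinP; apply: measurable_tr.
  have m21T : measurable_mx (fun w => (A21 (X w) (W w))^T) by exact: measurable_mxT.
  by do ?apply: measurable_mxD; do ?apply: measurable_mxM.
- apply: filterS aeM => w -> _; rewrite mxtrace_mulC [(_ + _)^T]linearD /= !trmx_mul !trmxK A11_sym.
  congr (\tr _)%:E; rewrite mulmxDl !mulmxDr !mulmxA -!addrA; congr (_ + _).
  by rewrite addrCA.
Qed.

Lemma test_error_noise_ols : (n0 <= n)%N -> (d0 <= n)%N ->
  (test_error P beta0 X e W x' e' =
    (sigma ^+ 2)%:E
    + \int[P]_w (enorm ((invmx ((X w)^T *m X w + (W w)^T *m W w)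
         *m (X w)^T *m X w - 1%:M) *m beta0) ^+ 2)%:E
    + (sigma ^+ 2)%:E * \int[P]_w (
       (let S := (X w)^T *m X w + (W w)^T *m W w in
        \tr ((X w)^T *m X w *m (invmx S *m invmx S))))%:E)%E.
Proof.
move=> n0n dn; have hN := train_size n0n.
have ME w : M w = invmx ((X w)^T *m X w + (W w)^T *m W w) *m (X w)^T.
  rewrite /fit_mx dn ols_rowsub // tr_col_mx mul_row_col -mulmxA mul_row_col.
  by rewrite mulmx1 mulmx0 addr0.
have e1 : (\int[P]_w (enorm ((M w *m X w - 1%:M) *m beta0) ^+ 2)%:E =
    \int[P]_w (enorm ((invmx ((X w)^T *m X w + (W w)^T *m W w)
         *m (X w)^T *m X w - 1%:M) *m beta0) ^+ 2)%:E)%E.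
  by apply: eq_integral => w _; rewrite ME.
rewrite test_error_decomposition e1; congr (_ + _ * _)%E.
apply: eq_integral => w _; rewrite ME; congr _%:E; set S := _ + _.
have SS : S^T = S by rewrite /S linearD /= !trmx_mul !trmxK.
rewrite [RHS]mxtrace_mulC trmx_mul trmxK trmx_inv SS mulmxA [LHS]mxtrace_mulC.
by rewrite !mulmxA.
Qed.

End TestError.

Theorem theorem3p2 (R : realType) (dsp : measure_display)
    (T : measurableType dsp) (P : probability T R)
    (n0 d0 : nat) (hn0 : (1 <= n0)%N) (hd0 : (1 <= d0)%N)
    (beta0 : 'cV[R]_d0) (sigma : R) (hsigma : 0 < sigma ^+ 2)
    (X : T -> 'M[R]_(n0, d0)) (e : T -> 'cV[R]_n0)
    (W : forall n : nat, T -> 'M[R]_(n - n0, d0))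
    (x' : T -> 'cV[R]_d0) (e' : T -> R)
    (hmodel : forall n : nat, (1 <= n)%N ->
       data_model P sigma X e (W n) x' e') :
  let D n w := train_design (X w) (W n w) in
  let u n w := train_response n (X w *m beta0 + e w) in
  let bhat n w := betahat beta0 X e (W n) w in
  let Rn n := test_error P beta0 X e (W n) x' e' in
  [/\ forall n : nat, (1 <= n)%N -> (n < minn n0 d0)%N ->
        [/\ forall w, bhat n w = min_norm_ols (D n w) (u n w),
            (n + 2 <= d0)%N ->
              Rn n = (enorm beta0 ^+ 2 * (1 - n%:R / d0%:R)
                      + sigma ^+ 2 * (1 + n%:R / (d0%:R - 1 - n%:R)))%:E
          & n = (d0 - 1)%N \/ n = d0 -> Rn n = +oo%E],
      (n0 < d0)%N -> forall n : nat, (1 <= n)%N -> (n0 <= n < d0)%N ->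
        (forall w, bhat n w = min_norm_ols (D n w) (u n w)) /\
        Rn n =
          ((sigma ^+ 2)%:E
           + 'E_P[fun w => (enorm
               (((X w)^T *m A11 (X w) (W n w) *m X w
                 + (W n w)^T *m A21 (X w) (W n w) *m X w
                 - 1%:M) *m beta0) ^+ 2)%R]
           + (sigma ^+ 2)%:E * 'E_P[fun w =>
              (let a11 := A11 (X w) (W n w) in
               let a21 := A21 (X w) (W n w) in
               \tr (a11 *m X w *m (X w)^T *m a11
                    + a21^T *m W n w *m (X w)^T *m a11
                    + a11 *m X w *m (W n w)^T *m a21
                    + a21^T *m W n w *m (W n w)^T *m a21))%R])%E,
      (d0 < n0)%N -> forall n : nat, (1 <= n)%N -> (d0 <= n < n0)%N ->
        [/\ forall w, bhat n w = ols (D n w) (u n w),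
            n = d0 \/ n = (d0 + 1)%N -> Rn n = +oo%E
          & (d0 + 2 <= n)%N ->
              Rn n = (sigma ^+ 2 * (1 + d0%:R / (n%:R - d0%:R - 1)))%:E]
    & forall n : nat, (1 <= n)%N -> (maxn n0 d0 < n)%N ->
        (forall w, bhat n w = ols (D n w) (u n w)) /\
        Rn n =
          ((sigma ^+ 2)%:E
           + 'E_P[fun w => (enorm
               ((invmx ((X w)^T *m X w + (W n w)^T *m W n w)
                   *m (X w)^T *m X w - 1%:M) *m beta0) ^+ 2)%R]
           + (sigma ^+ 2)%:E * 'E_P[fun w =>
              (let S := (X w)^T *m X w + (W n w)^T *m W n w in
               \tr ((X w)^T *m X w *m (invmx S *m invmx S)))%R])%E].
Proof.
have sigma0 : sigma != 0 by apply: contraTneq hsigma => ->; rewrite expr0n ltxx.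
have infE (b : \bar R) : (0 <= b)%E -> (b + (sigma ^+ 2)%:E * +oo = +oo)%E.
  move=> b0; rewrite gt0_muley ?lte_fin // addey // -ltNye.
  exact: lt_le_trans b0.
move=> D u bhat Rn; split.
- move=> n n1; rewrite leq_min => /andP[nn0 nd].
  have RnE := test_error_few_rows beta0 sigma0 (hmodel n n1) (ltnW nn0) n1 nd.
  split.
  + by move=> w; rewrite /bhat /betahat /estimator leqNgt nd.
  + move=> n2; rewrite /Rn RnE n2 -EFinM -!EFinD; congr _%:E.
    by rewrite addrAC -[d0%:R - 1 - n%:R]addrAC; ring.
  + move=> nE; rewrite /Rn RnE ifN ?infE //.
      by rewrite adde_ge0 ?lee_fin ?sqr_ge0 // mulr_ge0 ?sqr_ge0 // subr_ge0
         ler_pdivrMr ?ltr0n // mul1r ler_nat ltnW.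
    by case: nE => ->; lia.
- move=> n0d n n1 /andP[n0n nd].
  split; first by move=> w; rewrite /bhat /betahat /estimator leqNgt nd.
  by rewrite unlock; exact: (test_error_noise_min_norm beta0 sigma0 (hmodel n n1) n0n nd).
- move=> dn0 n n1 /andP[dn nn0].
  have RnE := test_error_many_rows beta0 sigma0 (hmodel n n1) (ltnW nn0) hd0 dn.
  split.
  + by move=> w; rewrite /bhat /betahat /estimator dn.
  + move=> nE; rewrite /Rn RnE ifN ?infE ?lee_fin ?sqr_ge0 //.
    by case: nE => ->; lia.
  + move=> n2; rewrite /Rn RnE n2 -EFinM -!EFinD; congr _%:E.
    by rewrite mulrDr mulr1.
- move=> n n1; rewrite gtn_max => /andP[n0n dn].
  split; first by move=> w; rewrite /bhat /betahat /estimator (ltnW dn).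
  by rewrite unlock; exact: (test_error_noise_ols beta0 sigma0 (hmodel n n1) (ltnW n0n) (ltnW dn)).
Qed.
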